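(* Let $m\geq 4$ be an even integer and $n$ an odd integer with $n\geq m^3-m-3$. Then the configuration $A_0(m,n)$ is superabundant and non-defective.
   Context: Work over $\mathbb{C}$. Let $\mathbb{P}^{m,n}=\mathbb{P}^m\times\mathbb{P}^n$ with bigraded coordinate ring $R=\mathbb{C}[x_0,\dots,x_m,y_0,\dots,y_n]$, where $\deg x_i=(1,0)$ and $\deg y_j=(0,1)$. A bihomogeneous $f\in R$ is singular at a point $P\in\mathbb{P}^{m,n}$ if all its partial derivatives vanish at $P$. Put $\overline{s}(m,n)=\left\lfloor\frac{(m+1)(n-m+2)}{2}\right\rfloor+1$. For $n\geq m-2$, $A_0(m,n)$ denotes the configuration of $\overline{s}(m,n)$ double points supported at general points of $\mathbb{P}^{m,n}$. Let $\mathcal{I}(1,2)$ be the vector space of bidegree $(1,2)$ forms in $R$ that are singular at all these points. The virtual dimension of $A_0(m,n)$ is $\operatorname{vdim}A_0(m,n)=(m+1)\binom{n+2}{2}-\overline{s}(m,n)\,(m+n+1)$. The configuration $A_0(m,n)$ is superabundant if $\operatorname{vdim}A_0(m,n)\leq 0$, and non-defective if, for a general choice of the points, $\dim_{\mathbb{C}}\mathcal{I}(1,2)=\max\{0,\operatorname{vdim}A_0(m,n)\}$. *)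

(* Defs.v *)
From HB Require Import structures.
From mathcomp Require Import all_boot all_order all_algebra.
From mathcomp Require Import reals complex.
From mathcomp Require Import mpoly.

Set Implicit Arguments.
Unset Strict Implicit.
Unset Printing Implicit Defensive.

Import Order.TTheory GRing.Theory Num.Theory.
Local Open Scope ring_scope.

(* The coordinate ring of P^m x P^n is {mpoly K[m.+1 + n.+1]}: the variable
   x_i is 'X_(lshift n.+1 i) and y_j is 'X_(rshift m.+1 j). *)

Definition xdeg (m n : nat) (a : 'X_{1..m.+1 + n.+1}) : nat :=
  (\sum_(i < m.+1) a (lshift n.+1 i))%N.

Definition ydeg (m n : nat) (a : 'X_{1..m.+1 + n.+1}) : nat :=
  (\sum_(j < n.+1) a (rshift m.+1 j))%N.

Definition bihomog (K : fieldType) (m n d e : nat)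
    (f : {mpoly K[m.+1 + n.+1]}) : Prop :=
  forall a, a \in msupp f -> xdeg a = d /\ ydeg a = e.

(* A point of P^m x P^n, given by a choice of homogeneous coordinates.  It is
   only ever tested against (multi)homogeneous equations, which do not depend
   on this choice. *)
Record bipoint (K : fieldType) (m n : nat) := BiPoint {
  xcoord : 'rV[K]_m.+1;
  ycoord : 'rV[K]_n.+1;
  xcoord_neq0 : xcoord != 0;
  ycoord_neq0 : ycoord != 0
}.

Definition coords (K : fieldType) (m n : nat) (P : bipoint K m n) :
    'rV[K]_(m.+1 + n.+1) :=
  row_mx (xcoord P) (ycoord P).

Definition singular_at (K : fieldType) (m n : nat)
    (f : {mpoly K[m.+1 + n.+1]}) (P : bipoint K m n) : Prop :=
  forall k : 'I_(m.+1 + n.+1), (f^`M(k)).@[coords P 0] = 0.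

(* Zariski topology on (P^m x P^n)^s.  The k-th homogeneous coordinate of the
   i-th point is the variable of index mxvec_index i k. *)

Definition config_coords (K : fieldType) (m n s : nat)
    (P : 'I_s -> bipoint K m n) : 'rV[K]_(s * (m.+1 + n.+1)) :=
  mxvec (\matrix_(i, k) coords (P i) 0 k).

Definition multihomog (K : fieldType) (m n s : nat)
    (F : {mpoly K[s * (m.+1 + n.+1)]}) : Prop :=
  exists d e : 'I_s -> nat, forall a, a \in msupp F -> forall i : 'I_s,
    (\sum_(k < m.+1) a (mxvec_index i (lshift n.+1 k)))%N = d i /\
    (\sum_(k < n.+1) a (mxvec_index i (rshift m.+1 k)))%N = e i.

Definition zariski_open (K : fieldType) (m n s : nat)
    (U : ('I_s -> bipoint K m n) -> Prop) : Prop :=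
  exists2 Z : {mpoly K[s * (m.+1 + n.+1)]} -> Prop,
    forall F, Z F -> multihomog F &
    forall P, U P <-> exists2 F, Z F & F.@[config_coords P 0] != 0.

Definition for_general (K : fieldType) (m n s : nat)
    (Q : ('I_s -> bipoint K m n) -> Prop) : Prop :=
  exists U, [/\ zariski_open U, exists P, U P & forall P, U P -> Q P].

(* The ambient space of the forms of bidegree (1, 2) is taken to be the
   finite-dimensional space of all forms of total degree 3. *)
Definition forms12 (K : fieldType) (m n s : nat) (P : 'I_s -> bipoint K m n)
    (f : dhomog (m.+1 + n.+1) K 3) : Prop :=
  bihomog 1 2 (f : {mpoly K[m.+1 + n.+1]}) /\
  forall i, singular_at (f : {mpoly K[m.+1 + n.+1]}) (P i).

Definition has_dim (K : fieldType) (E : vectType K) (S : E -> Prop) (d : nat) :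
    Prop :=
  exists2 V : {vspace E}, forall v, v \in V <-> S v & \dim V = d.

(* Used only for n >= m - 2, where n - m + 2 = n.+2 - m is not truncated. *)
Definition sbar (m n : nat) : nat := ((m.+1 * (n.+2 - m)) %/ 2).+1.

Definition vdimA0 (m n : nat) : int :=
  (m.+1 * 'C(n.+2, 2))%N%:Z - (sbar m n * (m + n + 1))%N%:Z.

Definition superabundantA0 (m n : nat) : Prop := vdimA0 m n <= 0.

Definition nondefectiveA0 (K : fieldType) (m n : nat) : Prop :=
  for_general (fun P : 'I_(sbar m n) -> bipoint K m n =>
    exists2 d : nat, has_dim (forms12 P) d &
      d%:Z = Num.max 0 (vdimA0 m n)).

(* Main.v *)
(* Split the y-space as W = W_0 + U_1 + ... + U_t with dim W_0 = m, dim U_i = 2.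
   Specialize m/2 + 1 of the points to coordinate points of V x W_0, and the
   others to t blocks of m + 1 points, the i-th block lying in V x (W_0 + U_i).
   A form B in V^* (x) S^2 W^* is then handled component by component.
   - Its restriction to W_0 lies in the space K_0 of the forms singular at the
     first points.  For every b in K_0 some block does not allow any nonzero
     multiple of b to extend to W_0 + U_i, and has no nonzero extension of 0
     either.  Choosing the blocks greedily, each one cuts down the space of the
     possible restrictions by one dimension, and the bound on n says that there
     are at least dim K_0 blocks.
   - The component in V^* (x) U_i^* (x) U_j^* vanishes as soon as the two blocks
     are transverse, which is an open condition.
   Hence no form is left for this special configuration, and a nonzero maximal
   minor of the matrix of the singularity conditions spreads this to general
   points. *)
Require Import Defs.
From mathcomp Require Import all_boot all_order all_algebra.
From mathcomp Require Import reals complex.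
From mathcomp Require Import fingroup perm.
From mathcomp Require Import boolp functions.
From mathcomp Require Import ring lra zify.
From mathcomp Require Import mpoly.

Set Implicit Arguments.
Unset Strict Implicit.
Unset Printing Implicit Defensive.

Import Order.TTheory GRing.Theory Num.Theory.
Local Open Scope ring_scope.

(** * Linear systems depending polynomially on parameters *)

Section LinearAlgebra.
Variable K : fieldType.

Definition subspace (E : lmodType K) (X : E -> Prop) : Prop :=
  X 0 /\ forall a u v, X u -> X v -> X (a *: u + v).

(** Induction on the codimension: a subspace contained in [X] grows by one missing vector of [X] at
    a time. Linear conditions stated as predicates acquire a dimension and a basis in this way. *)
Lemma subspace_vspace (E : vectType K) (X : E -> Prop) :
  subspace X -> exists Y : {vspace E}, forall v, v \in Y <-> X v.
Proof.
move=> [X0 XD].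
suff H k (Y : {vspace E}) : (\dim {:E} - \dim Y <= k)%N ->
    (forall v, v \in Y -> X v) -> exists Z : {vspace E}, forall v, v \in Z <-> X v.
  apply: (H _ 0%VS (leqnn _)) => v; by rewrite memv0 => /eqP->.
elim: k Y => [|k IH] Y hk hY.
  exists Y => v; split; first exact: hY.
  suff -> : Y = fullv by rewrite memvf.
  apply/eqP; rewrite eqEdim subvf /=; move: hk; lia.
have [h|/existsNP[v hv]] := pselect (forall v, X v -> v \in Y).
  by exists Y => v; split; [exact: hY | exact: h].
have [Xv /negP vY] : X v /\ ~ v \in Y by apply/not_implyP.
apply: (IH (Y + <[v]>)%VS).
  have : (\dim Y < \dim (Y + <[v]>))%N.
    rewrite ltn_neqAle dimvS ?addvSl // andbT; apply: contra vY => e.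
    have /eqP-> : (Y == Y + <[v]>)%VS by rewrite eqEdim addvSl (eqP e) leqnn.
    exact/(subvP (addvSr _ _))/memv_line.
  have := dimvS (subvf (Y + <[v]>)%VS); move: hk; lia.
move=> w /memv_addP[u uY [u' /vlineP[a ->] ->]]; rewrite addrC.
by apply: XD => //; exact: hY.
Qed.

(** On a basis of [Y] the functionals form a matrix with one row per condition; the common kernel is
    trivial exactly when the columns are independent. Stated with a minor, injectivity becomes a
    polynomial inequation in the parameters of [phi]. *)
Lemma injective_minor (E : vectType K) (Y : {vspace E}) (C : finType)
    (phi : C -> E -> K) :
    (forall c a u v, phi c (a *: u + v) = a * phi c u + phi c v) ->
  (forall v, v \in Y -> (forall c, phi c v = 0) -> v = 0) <->
  exists g : 'I_(\dim Y) -> C, \det (\matrix_(i, j) phi (g j) (vbasis Y)`_i) != 0.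
Proof.
move=> phiL; set b := vbasis Y.
have phi0 c : phi c 0 = 0.
  by move: (phiL c (-1) 0 0); rewrite scaler0 addr0 mulN1r addNr.
have phiS c (x : 'rV_(\dim Y)) :
    phi c (\sum_i x 0 i *: b`_i) = \sum_i x 0 i * phi c b`_i.
  elim/big_rec2: _ => [|i y1 y2 _ IH]; first exact: phi0.
  by rewrite phiL IH.
have bfree : free b := basis_free (vbasisP Y).
split.
  move=> inj.
  pose A : 'M[K]_(#|C|, \dim Y) := \matrix_(c, i) phi (enum_val c) b`_i.
  have fA : row_full A.
    rewrite /row_full -mxrank_tr -[_ == _]/(row_free A^T) -kermx_eq0.
    apply/rowV0P => x /sub_kermxP xA.
    have v0 : \sum_i x 0 i *: b`_i = 0.
      apply: inj.
        apply: memv_suml => i _; apply/memvZ/vbasis_mem/mem_nth.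
        by rewrite size_tuple.
      move=> c; transitivity ((x *m A^T) 0 (enum_rank c)); last by rewrite xA mxE.
      by rewrite phiS mxE; apply: eq_bigr => i _; rewrite !mxE enum_rankK.
    apply/rowP => i; rewrite mxE.
    by have /freeP := bfree; apply: (fun h => h (fun i => x 0 i) v0 i).
  exists (fun j => enum_val (fullrankfun fA j)).
  have := fullrowsub_unit fA; rewrite unitmxE unitfE -det_tr; congr (_ != 0).
  by congr (\det _); apply/matrixP => i j; rewrite !mxE.
move=> [g /det0P/= h] v vY v0.
have [//|vn0] := eqVneq v 0; exfalso; apply: h.
exists (\row_i coord b i v).
  apply: contra vn0 => /eqP/rowP c0.
  rewrite (coord_vbasis vY) big1 // => i _.
  by move: (c0 i); rewrite !mxE => ->; rewrite scale0r.
have vE : v = \sum_i (\row_i coord b i v) 0 i *: b`_i.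
  by rewrite [LHS](coord_vbasis vY); apply: eq_bigr => i _; rewrite mxE.
apply/rowP => j; transitivity (phi (g j) v); last by rewrite v0 mxE.
by rewrite vE phiS mxE -vE; apply: eq_bigr => i _; rewrite !mxE.
Qed.

Definition polyfun (f : K -> K) : Prop := exists q : {poly K}, forall s, f s = q.[s].

Lemma polyfun_cst c : polyfun (fun=> c).
Proof. by exists c%:P => s; rewrite hornerC. Qed.

Lemma polyfun_id : polyfun id.
Proof. by exists 'X => s; rewrite hornerX. Qed.

Lemma polyfunD f g : polyfun f -> polyfun g -> polyfun (fun s => f s + g s).
Proof. by move=> [p hp] [q hq]; exists (p + q) => s; rewrite hornerD hp hq. Qed.

Lemma polyfunM f g : polyfun f -> polyfun g -> polyfun (fun s => f s * g s).
Proof. by move=> [p hp] [q hq]; exists (p * q) => s; rewrite hornerM hp hq. Qed.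

Lemma polyfun_sum (I : Type) (r : seq I) (P : pred I) (F : I -> K -> K) :
  (forall i, polyfun (F i)) -> polyfun (fun s => \sum_(i <- r | P i) F i s).
Proof.
move=> /choice[q hq]; exists (\sum_(i <- r | P i) q i) => s.
by rewrite horner_sum; apply: eq_bigr => i _; rewrite hq.
Qed.

Lemma polyfun_prod (I : Type) (r : seq I) (P : pred I) (F : I -> K -> K) :
  (forall i, polyfun (F i)) -> polyfun (fun s => \prod_(i <- r | P i) F i s).
Proof.
move=> /choice[q hq]; exists (\prod_(i <- r | P i) q i) => s.
by rewrite horner_prod; apply: eq_bigr => i _; rewrite hq.
Qed.

Lemma polyfun_det n (A : K -> 'M[K]_n) :
  (forall i j, polyfun (fun s => A s i j)) -> polyfun (fun s => \det (A s)).
Proof.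
move=> hA; apply: polyfun_sum => s; apply: polyfunM; first exact: polyfun_cst.
exact: polyfun_prod.
Qed.

Definition line (S : Type) (a b : S -> K) (s : K) : S -> K :=
  fun x => a x + s * (b x - a x).

Lemma line0 S (a b : S -> K) : line a b 0 = a.
Proof. by apply: funext => x; rewrite /line mul0r addr0. Qed.

Lemma line_rev S (a b : S -> K) s : line b a s = line a b (1 - s).
Proof. apply: funext => x; rewrite /line; ring. Qed.

Lemma polyfun_line S (a b : S -> K) x : polyfun (fun s => line a b s x).
Proof.
apply: polyfunD; first exact: polyfun_cst.
apply: polyfunM; [exact: polyfun_id | exact: polyfun_cst].
Qed.

(* A weak form of Zariski openness, enough to intersect nonempty open sets. *)
Definition line_open (S : Type) (G : (S -> K) -> Prop) : Prop :=
  forall a b, G a -> exists2 q : {poly K}, q != 0 &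
    forall s, q.[s] != 0 -> G (line a b s).

(** A maximal minor that is nonzero at [a] restricts to the line as a polynomial in [s] whose value
    at 0 is nonzero. *)
Lemma line_open_injective (S : Type) (E : vectType K) (X : E -> Prop)
    (C : finType) (phi : (S -> K) -> C -> E -> K) :
    subspace X ->
    (forall P c a u v, phi P c (a *: u + v) = a * phi P c u + phi P c v) ->
    (forall c v P Q, polyfun (fun s => phi (line P Q s) c v)) ->
  line_open (fun P => forall v, X v -> (forall c, phi P c v = 0) -> v = 0).
Proof.
move=> /subspace_vspace[Y hY] phiL phiP a b Ga.
have [/(_ _)[|g]] := injective_minor Y (phiL a).
  by move=> v /hY; exact: Ga.
move=> hg _.
have [|q hq] := @polyfun_det _ (fun s =>
    \matrix_(i, j) phi (line a b s) (g j) (vbasis Y)`_i).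
  move=> i j; under [X in polyfun X]eq_fun do rewrite mxE; exact: phiP.
exists q.
  apply/eqP => q0; move: (hq 0); rewrite q0 horner0 line0 => e.
  by rewrite e eqxx in hg.
move=> s; rewrite -hq => qs v /hY.
by apply/(injective_minor Y (phiL _)): v; exists g.
Qed.

Lemma line_open_ex (S : Type) (I : Type) (G : I -> (S -> K) -> Prop) :
  (forall i, line_open (G i)) -> line_open (fun P => exists i, G i P).
Proof.
move=> oG a b [i Ga]; have [q q0 hq] := oG i a b Ga.
by exists q => // s /hq; exists i.
Qed.

Lemma line_openI (S : Type) (G H : (S -> K) -> Prop) :
  line_open G -> line_open H -> line_open (fun P => G P /\ H P).
Proof.
move=> oG oH a b [Ga Ha].
have [q q0 hq] := oG a b Ga; have [r r0 hr] := oH a b Ha.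
exists (q * r); first by rewrite mulf_neq0.
move=> s; rewrite hornerM mulf_eq0 negb_or => /andP[/hq ? /hr ?]; split=> //.
Qed.

End LinearAlgebra.

(** * Common points of nonempty open conditions *)

Section NumField.
Variable K : numFieldType.

(** In characteristic 0 the naturals below [size q] are distinct and outnumber the possible
    roots. *)
Lemma poly_nonroot (q : {poly K}) : q != 0 -> exists s, q.[s] != 0.
Proof.
move=> q0; apply: contrapT => /forallNP h.
have: (size [seq i%:R : K | i <- iota 0 (size q)] < size q)%N.
  apply: max_poly_roots => //.
    by apply/allP => x _; apply: contrapT => /negP; exact: h.
  by rewrite map_inj_uniq ?iota_uniq // => i j /eqP; rewrite eqr_nat => /eqP.
by rewrite size_map size_iota ltnn.
Qed.

(** On the line joining a point of [G] to a point of [H], each condition fails for finitely many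
    parameters only. *)
Lemma line_open_meet (S : Type) (G H : (S -> K) -> Prop) :
    line_open G -> line_open H -> (exists P, G P) -> (exists P, H P) ->
  exists P, G P /\ H P.
Proof.
move=> oG oH [a Ga] [b Hb].
have [q q0 hq] := oG a b Ga; have [r r0 hr] := oH b a Hb.
(* [r] belongs to the line run from [b] to [a]; substituting 1 - X rewrites it in the parameter of
   the line from [a] to [b]. *)
have [|s] := @poly_nonroot (q * (r \Po (1 - 'X))).
  rewrite mulf_neq0 // -size_poly_eq0 size_comp_poly2 ?size_poly_eq0 //.
  rewrite -opprB size_polyN -[1]/(1%:P); exact: size_XsubC.
rewrite hornerM mulf_eq0 negb_or horner_comp !hornerE => /andP[/hq Gs /hr].
rewrite line_rev subKr => Hs; by exists (line a b s).
Qed.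

Lemma line_open_meet_seq (S : Type) (I : eqType) (r : seq I) (G : I -> (S -> K) -> Prop)
    (H : (S -> K) -> Prop) :
    line_open H -> (exists P, H P) ->
    (forall i, i \in r -> line_open (G i) /\ exists P, G i P) ->
  exists2 P, H P & forall i, i \in r -> G i P.
Proof.
elim: r H => [|i r IH] H oH eH hG; first by case: eH => P HP; exists P.
have [oi ei] := hG i (mem_head _ _).
have [|||P [HP Gi] Gr] := IH (fun P => H P /\ G i P).
- exact: line_openI.
- exact: line_open_meet.
- by move=> j jr; apply: hG; rewrite inE jr orbT.
by exists P => // j; rewrite inE => /orP[/eqP->//|]; exact: Gr.
Qed.

End NumField.

(** * Coefficient tensors *)

Section Trilinear.
Variable K : fieldType.

Definition tensor (T I J : finType) := {ffun T * I * J -> K^o}.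

Section Ops.
Variables T I J : finType.
Implicit Types (B : tensor T I J) (v : T -> K^o) (y : I -> K^o) (z : J -> K^o).

Definition tri B v y z : K := \sum_t B t * (v t.1.1 * y t.1.2 * z t.2).

Lemma tri_linear0 a B C v y z : tri (a *: B + C) v y z = a * tri B v y z + tri C v y z.
Proof.
rewrite /tri big_distrr -big_split; apply: eq_bigr => t _ /=.
by rewrite !ffunE mulrDl [X in _ = X + _]mulrA.
Qed.

Lemma tri0t v y z : tri 0 v y z = 0.
Proof. by rewrite /tri big1 // => t _; rewrite ffunE mul0r. Qed.

Lemma tri_linear1 B a v v' y z : tri B (a *: v + v') y z = a * tri B v y z + tri B v' y z.
Proof.
rewrite /tri big_distrr -big_split; apply: eq_bigr => t _ /=.
rewrite -[(a *: v + v') _]/((a : K) * (v _ : K) + (v' _ : K) : K); ring.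
Qed.

Lemma tri_linear2 B a v y y' z : tri B v (a *: y + y') z = a * tri B v y z + tri B v y' z.
Proof.
rewrite /tri big_distrr -big_split; apply: eq_bigr => t _ /=.
rewrite -[(a *: y + y') _]/((a : K) * (y _ : K) + (y' _ : K) : K); ring.
Qed.

Lemma tri_linear3 B a v y z z' : tri B v y (a *: z + z') = a * tri B v y z + tri B v y z'.
Proof.
rewrite /tri big_distrr -big_split; apply: eq_bigr => t _ /=.
rewrite -[(a *: z + z') _]/((a : K) * (z _ : K) + (z' _ : K) : K); ring.
Qed.

Lemma tri01 B y z : tri B 0 y z = 0.
Proof. by rewrite /tri big1 // => t _; rewrite !mul0r mulr0. Qed.
Lemma tri02 B v z : tri B v 0 z = 0.
Proof. by rewrite /tri big1 // => t _; rewrite mulr0 mul0r mulr0. Qed.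
Lemma tri03 B v y : tri B v y 0 = 0.
Proof. by rewrite /tri big1 // => t _; rewrite !mulr0. Qed.

Lemma triD1 B v v' y z : tri B (v + v') y z = tri B v y z + tri B v' y z.
Proof. by rewrite -[v]scale1r tri_linear1 mul1r scale1r. Qed.
Lemma triD2 B v y y' z : tri B v (y + y') z = tri B v y z + tri B v y' z.
Proof. by rewrite -[y]scale1r tri_linear2 mul1r scale1r. Qed.
Lemma triD3 B v y z z' : tri B v y (z + z') = tri B v y z + tri B v y z'.
Proof. by rewrite -[z]scale1r tri_linear3 mul1r scale1r. Qed.
Lemma triZ1 B a v y z : tri B (a *: v) y z = a * tri B v y z.
Proof. by rewrite -[a *: v]addr0 tri_linear1 tri01 addr0. Qed.
Lemma triZ2 B a v y z : tri B v (a *: y) z = a * tri B v y z.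
Proof. by rewrite -[a *: y]addr0 tri_linear2 tri02 addr0. Qed.
Lemma triZ3 B a v y z : tri B v y (a *: z) = a * tri B v y z.
Proof. by rewrite -[a *: z]addr0 tri_linear3 tri03 addr0. Qed.
Lemma triN1 B v y z : tri B (- v) y z = - tri B v y z.
Proof. by rewrite -scaleN1r triZ1 mulN1r. Qed.
Lemma triN2 B v y z : tri B v (- y) z = - tri B v y z.
Proof. by rewrite -scaleN1r triZ2 mulN1r. Qed.
Lemma triN3 B v y z : tri B v y (- z) = - tri B v y z.
Proof. by rewrite -scaleN1r triZ3 mulN1r. Qed.

Definition triE := (triD1, triD2, triD3, triN1, triN2, triN3, triZ1, triZ2, triZ3).

End Ops.

Definition delta (I : finType) (i : I) : I -> K^o := fun j => (j == i)%:R.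

Lemma vec_delta (I : finType) (v : I -> K^o) : v = \sum_i v i *: delta i.
Proof.
apply: funext => j; rewrite fct_sumE (bigD1 j) //= big1 ?addr0.
  by rewrite -[LHS]mulr1 -[X in _ * X]/(true%:R) -(eqxx j).
by move=> i ij; rewrite -[LHS]/(v i * (j == i)%:R) eq_sym (negbTE ij) mulr0.
Qed.

Lemma tri_delta T I J (B : tensor T I J) k a b :
  tri B (delta k) (delta a) (delta b) = B (k, a, b).
Proof.
rewrite /tri (bigD1 (k, a, b)) //= big1 ?addr0 /delta ?eqxx ?mulr1 //.
move=> [[k' a'] b'] /=; rewrite !xpair_eqE.
by do 3!case: eqP => _ /=; rewrite ?(mulr0, mul0r).
Qed.

Lemma tri_sum1 T I J (B : tensor T I J) v y z :
  tri B v y z = \sum_k v k * tri B (delta k) y z.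
Proof.
rewrite [in LHS](vec_delta v); elim/big_rec2: _ => [|i u w _ <-].
  by rewrite tri01.
by rewrite tri_linear1.
Qed.

Lemma tri_sum3 T I J (B : tensor T I J) v y z :
  tri B v y z = \sum_k z k * tri B v y (delta k).
Proof.
rewrite [in LHS](vec_delta z); elim/big_rec2: _ => [|i u w _ <-].
  by rewrite tri03.
by rewrite tri_linear3.
Qed.

Lemma tensor_eq0 T I J (B : tensor T I J) :
  (forall v y z, tri B v y z = 0) -> B = 0.
Proof. by move=> h; apply/ffunP => -[[k a] b]; rewrite -tri_delta h ffunE. Qed.

Lemma tri_swap T I J (B : tensor T I J) v y z :
  tri [ffun t => B (t.1.1, t.2, t.1.2)] v y z = tri B v z y.
Proof.
rewrite /tri (reindex (fun t : T * I * J => (t.1.1, t.2, t.1.2))) /=.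
  by apply: eq_bigr => -[[k a] b] _ /=; rewrite ffunE /= mulrAC.
by exists (fun t : T * J * I => (t.1.1, t.2, t.1.2)) => -[[]].
Qed.

(** The linear map sending the basis vector [i] to the basis vector [h i]; for injective [h], the
    inclusion of a coordinate subspace. *)
Definition push (I I' : finType) (h : I -> I') (y : I -> K^o) : I' -> K^o :=
  fun a => \sum_(i | h i == a) y i.

Definition pull (T T' I I' J J' : finType) (f : T -> T') (g : I -> I') (h : J -> J')
    (B : tensor T' I' J') : tensor T I J :=
  [ffun t => B (f t.1.1, g t.1.2, h t.2)].

(** [push] and [pull] are adjoint: the sum is grouped by the fibres of the index maps. *)
Lemma tri_push (T T' I I' J J' : finType) (f : T -> T') (g : I -> I') (h : J -> J')
    (B : tensor T' I' J') v y z :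
  tri B (push f v) (push g y) (push h z) = tri (pull f g h B) v y z.
Proof.
rewrite /tri [RHS](partition_big (fun t => (f t.1.1, g t.1.2, h t.2)) xpredT) //=.
apply: eq_bigr => -[[k a] b] _ /=.
transitivity (\sum_(i | (f i.1.1, g i.1.2, h i.2) == (k, a, b))
    B (k, a, b) * (v i.1.1 * y i.1.2 * z i.2)); last first.
  by apply: eq_bigr => -[[k' a'] b'] /= /eqP <-; rewrite ffunE.
rewrite -big_distrr /=; congr (_ * _).
rewrite /push big_distrlr /= pair_big /= big_distrlr /= pair_big /=.
by apply: eq_bigl => -[[k' a'] b']; rewrite !xpair_eqE.
Qed.

Lemma push_delta (I I' : finType) (h : I -> I') i : push h (delta i) = delta (h i).
Proof.
apply: funext => a; rewrite /push /delta.
have [->|na] := eqVneq a (h i).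
  rewrite (bigD1 i) //= eqxx big1 ?addr0 // => j /andP[_ /negbTE->]; by [].
by rewrite big1 // => j /eqP hj; case: eqP => // ji; rewrite -hj ji eqxx in na.
Qed.

Lemma push_id (I : finType) (y : I -> K^o) : push id y = y.
Proof. by apply: funext => a; rewrite /push big_pred1_eq. Qed.

Lemma push_linear (I I' : finType) (h : I -> I') a (y y' : I -> K^o) :
  push h (a *: y + y') = a *: push h y + push h y'.
Proof.
apply: funext => i; rewrite /push big_split /=; congr (_ + _).
by rewrite -[RHS]/(a * _) big_distrr.
Qed.

End Trilinear.

(** * Singular points *)

Section Singular.
Variable K : fieldType.

Lemma line_open_neq0 (S : Type) (F : (S -> K) -> K) :
  (forall a b, polyfun (fun s => F (line a b s))) -> line_open (fun P => F P != 0).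
Proof.
move=> hF a b Fa; have [q hq] := hF a b.
exists q; last by move=> s; rewrite hq.
by apply: contra Fa => /eqP q0; rewrite -[a](line0 a b) hq q0 horner0.
Qed.

Section Points.
Variables T I : finType.
Implicit Types (B : tensor K T I I) (P : T + I -> K).

Definition xpart P : T -> K^o := fun k => P (inl k).
Definition ypart P : I -> K^o := fun a => P (inr a).
Definition point (x : T -> K^o) (y : I -> K^o) : T + I -> K :=
  fun i => match i with inl k => x k | inr a => y a end.

Definition symmetric_tensor B : Prop := forall k a b, B (k, a, b) = B (k, b, a).

Lemma tri_sym B v y z : symmetric_tensor B -> tri B v y z = tri B v z y.
Proof.
move=> sB; rewrite -tri_swap; congr (tri _ _ _ _).
by apply/ffunP => -[[k a] b]; rewrite ffunE.
Qed.

(* The (1, 2)-form with coefficient tensor [B] is singular at [P]. *)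
Definition singular B P : Prop :=
  (forall v, tri B v (ypart P) (ypart P) = 0) /\
  (forall z, tri B (xpart P) (ypart P) z = 0).

Definition singular_eq P (c : T + I) B : K :=
  match c with
  | inl k => tri B (delta K k) (ypart P) (ypart P)
  | inr a => tri B (xpart P) (ypart P) (delta K a)
  end.

(** By linearity basis vectors suffice, which leaves finitely many conditions, as the minor
    criterion demands. *)
Lemma singularP B P : singular B P <-> forall c, singular_eq P c B = 0.
Proof.
split=> [[h1 h2] [k|a] /=|h]; rewrite ?h1 ?h2 //.
split=> [v|z].
  by rewrite tri_sum1 big1 // => i _; rewrite [X in _ * X](h (inl i)) mulr0.
by rewrite tri_sum3 big1 // => i _; rewrite [X in _ * X](h (inr i)) mulr0.
Qed.

Lemma singular_eq_linear P c a B B' :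
  singular_eq P c (a *: B + B') = a * singular_eq P c B + singular_eq P c B'.
Proof. by case: c => i; rewrite /= tri_linear0. Qed.

Lemma singular_subspace P : subspace (fun B => singular B P).
Proof.
split; first by split=> *; rewrite tri0t.
move=> a u v /singularP hu /singularP hv; apply/singularP => c.
by rewrite singular_eq_linear hu hv mulr0 addr0.
Qed.

Lemma symmetric_subspace : subspace symmetric_tensor.
Proof.
split=> [k a b|c u v hu hv k a b]; rewrite !ffunE //.
by rewrite hu hv.
Qed.

(** All points are packed into one function on [J * (T + I)], so that [line] moves them
    simultaneously. *)
Definition nonsingular (X : tensor K T I I -> Prop) (J : finType)
    (P : J * (T + I) -> K) : Prop :=
  forall B, X B -> (forall j, singular B (fun i => P (j, i))) -> B = 0.

End Points.

Lemma polyfun_tri T I J (B : tensor K T I J) (v : K -> T -> K^o)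
    (y : K -> I -> K^o) (z : K -> J -> K^o) :
    (forall i, polyfun (fun s => v s i)) -> (forall i, polyfun (fun s => y s i)) ->
    (forall i, polyfun (fun s => z s i)) ->
  polyfun (fun s => tri B (v s) (y s) (z s)).
Proof.
move=> hv hy hz; apply: polyfun_sum => t; apply: polyfunM; first exact: polyfun_cst.
by apply: polyfunM => //; apply: polyfunM.
Qed.

Lemma line_open_nonsingular (T I J : finType) (X : tensor K T I I -> Prop) :
  subspace X -> line_open (@nonsingular T I X J).
Proof.
move=> sX a b Ga.
pose phi (P : J * (T + I) -> K) (c : J * (T + I)) B :=
  singular_eq (fun i => P (c.1, i)) c.2 B.
have [|||q q0 hq] := @line_open_injective K _ _ X _ phi sX _ _ a b.
- by move=> P c u B B'; rewrite /phi singular_eq_linear.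
- move=> [j [k|i]] B P Q; apply: polyfun_tri => i'; try exact: polyfun_cst;
  exact: polyfun_line.
- move=> B XB h; apply: Ga => // j; apply/singularP => c; exact: (h (j, c)).
exists q => // s /hq h B XB sB; apply: h => // -[j c].
by rewrite /phi; have /singularP := sB j; apply.
Qed.

(* Two blocks of points, projected to their planes [U] and [U'], leave no form
   of V^* (x) U^* (x) U'^*. *)
Definition transverse (T I : finType)
    (P Q : T * (T + (I + bool)) -> K) : Prop :=
  forall C : tensor K T bool bool,
    (forall k z, tri C (fun i => P (k, inl i)) (fun c => P (k, inr (inr c))) z = 0) ->
    (forall k z, tri C (fun i => Q (k, inl i)) z (fun c => Q (k, inr (inr c))) = 0) ->
  C = 0.

(** For fixed [Q] its conditions cut out a fixed subspace [X] of tensors; only the functionals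
    coming from [P] move. *)
Lemma line_open_transverse_l (T I : finType) Q :
  line_open (fun P => @transverse T I P Q).
Proof.
pose X (C : tensor K T bool bool) := forall k z,
  tri C (fun i => Q (k, inl i)) z (fun c => Q (k, inr (inr c))) = 0.
have sX : subspace X.
  split=> [k z|u C C' hC hC' k z]; first exact: tri0t.
  by rewrite tri_linear0 hC hC' mulr0 addr0.
pose phi (P : T * (T + (I + bool)) -> K) (c : T * bool) (C : tensor K T bool bool) :=
  tri C (fun i => P (c.1, inl i)) (fun c' => P (c.1, inr (inr c'))) (delta K c.2).
move=> a b Ga; have [|||q q0 hq] := @line_open_injective K _ _ X _ phi sX _ _ a b.
- by move=> P c u B B'; rewrite /phi tri_linear0.
- move=> [j c] B P P'; apply: polyfun_tri => i'; try exact: polyfun_cst;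
  exact: polyfun_line.
- move=> C XC h; apply: Ga => // k z.
  by rewrite tri_sum3 big1 // => c _; rewrite [X in _ * X](h (k, c)) mulr0.
by exists q => // s /hq h C hP hC; apply: h => // -[k c]; apply: hP.
Qed.

Lemma transverse_sym (T I : finType) P Q :
  @transverse T I P Q -> @transverse T I Q P.
Proof.
move=> h C hQ hP.
pose D : tensor K T bool bool := [ffun t => C (t.1.1, t.2, t.1.2)].
have CD v y z : tri D v y z = tri C v z y := tri_swap C v y z.
have D0 : D = 0 by apply: h => k z; rewrite CD ?hQ ?hP.
apply/ffunP => -[[k a] b]; have /ffunP/(_ (k, b, a)) := D0.
by rewrite !ffunE /=.
Qed.

(** In the greedy choice this ensures that a chosen block still admits transverse partners among the
    later ones. *)
Lemma line_open_transverse_r (T I : finType) :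
  line_open (fun Q => exists P, @transverse T I P Q).
Proof.
apply: line_open_ex => P a b /transverse_sym Ga.
have [q q0 hq] := @line_open_transverse_l _ _ P _ b Ga.
by exists q => // s /hq h; apply: transverse_sym.
Qed.

End Singular.

(** * One block of points *)

Section Block.
Variables (K : numFieldType) (A : finType) (a0 : A).

(* With r = #|A| + 2, the dimensions are #|GI| = r, #|TI| = 2r - 1 = dim V and
   #|WI| = 2r - 2 = dim W_0. *)
Let GI : finType := (bool + A)%type.
Let TI : finType := ((unit + bool) + A * bool)%type.
Let WI : finType := ((bool + A) + A)%type.

Notation d := (@delta K _).

Definition base_index (i : GI) : TI :=
  match i with inl b => inl (inr b) | inr a => inr (a, true) end.

Definition base_point (I : finType) (h : WI -> I) (i : GI) : TI + I -> K :=
  point (d (base_index i)) (d (h (inl i))).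

(** The space K_0 of the outline. *)
Definition residual (b : tensor K TI WI WI) : Prop :=
  symmetric_tensor b /\ forall i, singular b (base_point id i).

(** Allowing every multiple of [b], including 0, makes the condition linear and treats the
    extensions of [b] and of 0 together. *)
Definition extension (b : tensor K TI WI WI) (B : tensor K TI (WI + bool)%type (WI + bool)%type) :=
  [/\ symmetric_tensor B, exists c : K, pull id inl inl B = c *: b &
      forall i, singular B (base_point inl i)].

(* The block [P] prevents the nonzero multiples of [b], and the nonzero forms
   vanishing on W_0, from being singular on the whole block. *)
Definition killing (b : tensor K TI WI WI) (P : TI * (TI + (WI + bool)) -> K) : Prop :=
  nonsingular (extension b) P.

Lemma extension_subspace b : subspace (extension b).
Proof.
split.
  split.
  - exact: (symmetric_subspace _ _ _).1.
  - by exists 0; rewrite scale0r; apply/ffunP => t; rewrite !ffunE.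
  - by move=> i; exact: (singular_subspace _).1.
move=> u B B' [s1 [c1 e1] h1] [s2 [c2 e2] h2]; split.
- exact: (symmetric_subspace _ _ _).2.
- exists (u * c1 + c2); rewrite scalerDl -scalerA -e1 -e2.
  by apply/ffunP => t; rewrite !ffunE.
- by move=> i; apply: (singular_subspace _).2.
Qed.

(** Polarization at y + z recovers twice the bilinear value, and 2 is invertible. *)
Lemma tri_polarize (I : finType) (b : tensor K TI I I) :
  symmetric_tensor b -> b != 0 -> exists v y, tri b v y y != 0.
Proof.
move=> sb; apply: contraNP => h; apply/eqP/tensor_eq0 => v y z.
have q0 v' y' : tri b v' y' y' = 0.
  by apply: contrapT => /eqP n; apply: h; exists v', y'.
have := q0 v (y + z); rewrite !triE !q0 addr0 add0r (tri_sym v z y sb).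
by move=> /eqP; rewrite -mulr2n mulrn_eq0 => /eqP.
Qed.

Let k0 : TI := inl (inl tt).
Let f_ (i : GI) : WI -> K^o := d (inl i).
Let e_ (i : GI) : TI -> K^o := d (base_index i).
Let iF : GI := inl false.
Let iT : GI := inl true.

(** * An explicit killing block *)

Section Configuration.
Variables (b : tensor K TI WI WI) (p : TI -> K^o) (y : WI -> K^o).
Hypothesis resb : residual b.
Hypothesis p0 : p k0 != 0.
Hypothesis y0 : y (inr a0) != 0.
(** This scalar ends up multiplying [c] in a combination of the singularity conditions. *)
Hypothesis by0 : b != 0 -> 2 * tri b p y (f_ iF) - tri b p y y != 0.

(** Pairwise distinct scalars; the successor reserves the value 0 for [k0]. *)
Let tau (k : TI) : K := if k == k0 then 0 else (enum_rank k).+1%:R.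

Let tau_inj : injective tau.
Proof.
move=> k l; rewrite /tau; case: eqP => [->|_]; case: eqP => [->|_] //.
- by move=> /eqP; rewrite eq_sym pnatr_eq0.
- by move=> /eqP; rewrite pnatr_eq0.
by move=> /eqP; rewrite eqr_nat eqSS => /eqP/val_inj/enum_rank_inj.
Qed.

(** A basis of V in which every base vector [e_ i] is a sum of two members; these pairs link the
    block to the base points. *)
Let pp (k : TI) : TI -> K^o :=
  match k with
  | inl (inl _) => p
  | inl (inr c) => e_ (inl c) - p
  | inr (a, true) => e_ (inr a) - d (inr (a, false))
  | inr (a, false) => d (inr (a, false))
  end.

(** The values at [inl (inr false)] and [inr (a0, false)] yield both [f_ iF] and [y]; here [y]
    stands in for the basis vector [inr a0]. *)
Let zz (k : TI) : WI -> K^o :=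
  match k with
  | inl (inl _) => 0
  | inl (inr true) => f_ iT
  | inl (inr false) => f_ iF + y
  | inr (a, true) => f_ (inr a)
  | inr (a, false) => if a == a0 then f_ iF - y else d (inr a)
  end.

Let iota : (WI -> K^o) -> (WI + bool -> K^o) := push inl.
Let e1 : WI + bool -> K^o := d (inr false).
Let e2 : WI + bool -> K^o := d (inr true).

Let ww k : WI -> K^o := tau k *: zz k.
(** The projections to U lie on one affine line, so differences of points contain no [e1]. *)
Let uu k : WI + bool -> K^o := iota (ww k) + e1 + tau k *: e2.
Let theta (x : TI * (TI + (WI + bool))) : K := point (pp x.1) (uu x.1) x.2.

(** The other [pp k], with [p], produce every basis vector but [d k0]; then [p] produces that one
    because [p k0] is nonzero. *)
Let pp_span (psi : (TI -> K^o) -> K) :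
    (forall a u v, psi (a *: u + v) = a * psi u + psi v) ->
    (forall k, psi (pp k) = 0) -> forall k, psi (d k) = 0.
Proof.
move=> psiL psi0.
have psiD u v : psi (u + v) = psi u + psi v by rewrite -[u]scale1r psiL mul1r scale1r.
have psiZ a u : psi (a *: u) = a * psi u.
  have z0 : psi 0 = 0 by move: (psiL (-1) 0 0); rewrite scaler0 addr0 mulN1r addNr.
  by rewrite -[a *: u]addr0 psiL z0 addr0.
have h c : psi (d (inl (inr c))) = 0.
  have := psi0 (inl (inr c)); rewrite /= -scaleN1r psiD psiZ.
  by rewrite [psi p](psi0 k0) mulr0 addr0.
have h1 a : psi (d (inr (a, false))) = 0 := psi0 (inr (a, false)).
have h2 a : psi (d (inr (a, true))) = 0.
  have := psi0 (inr (a, true)); rewrite /= -scaleN1r psiD psiZ.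
  by rewrite h1 mulr0 addr0.
have ha k : k != k0 -> psi (d k) = 0.
  by case: k => [[[]|c]|[a []]] //; rewrite ?eqxx.
move=> k; have [->|/ha//] := eqVneq k k0.
have : psi p = p k0 * psi (d k0).
  rewrite [in LHS](vec_delta p) (bigD1 k0) //= psiL.
  elim/big_rec: _ => [|i u ik IH].
    by rewrite -[0](scale0r (d k0)) psiZ mul0r addr0.
  rewrite psiL (ha _ ik) mulr0 add0r; exact: IH.
by rewrite [psi p](psi0 k0) => /esym/eqP; rewrite mulf_eq0 (negbTE p0) => /eqP.
Qed.

(** Differences of points relate the components [L] (W_0 against [e2]) and [g] ([e2] against [e2]).
    The relations force first the restriction to W_0, then [g] and [L] to vanish; the components
    along [e1] follow from singularity at each point. *)
Lemma configuration_killing : killing b theta.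
Proof.
move=> B [sB [c cB] hB] hP.
have [sb hb] := resb.
pose F := tri B; pose q k := tri b (pp k).
have Fsym v u w : F v u w = F v w u by exact: tri_sym.
have Fb v u w : F v (iota u) (iota w) = c * tri b v u w.
  rewrite /F -[v in LHS](push_id v) tri_push cB -[c *: b]addr0 tri_linear0 tri0t.
  by rewrite addr0.
have qsym k u w : q k u w = q k w u by exact: tri_sym.
have H1 k v : F v (uu k) (uu k) = 0 by exact: (hP k).1.
have H2 k z : F (pp k) (uu k) z = 0 by exact: (hP k).2.
have G1 i v : tri b v (f_ i) (f_ i) = 0 by exact: (hb i).1.
have G2 i z : F (e_ i) (iota (f_ i)) z = 0.
  by rewrite /iota /f_ push_delta; exact: (hB i).2.
pose L k u := F (pp k) (iota u) e2; pose g k := F (pp k) e2 e2.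
have iD u v : iota (u + v) = iota u + iota v.
  by rewrite -[u]scale1r /iota push_linear !scale1r.
have i0 : iota 0 = 0 by apply: funext => i; rewrite /iota /push big1.
have iZ a u : iota (a *: u) = a *: iota u.
  by rewrite -[a *: u]addr0 /iota push_linear -/iota i0 addr0.
have iN u : iota (- u) = - iota u by rewrite -scaleN1r iZ scaleN1r.
have LD k u v : L k (u + v) = L k u + L k v by rewrite /L iD /F triE.
have LZ k a u : L k (a *: u) = a * L k u by rewrite /L iZ /F triE.
have LN k u : L k (- u) = - L k u by rewrite /L iN /F triE.
have LZ0 k : L k 0 = 0 by rewrite /L i0 /F tri02.
(* [R] expands F p_k (P_j - P_k) (P_j - P_k) = 0, where P_j = uu j. *)
have R k j : c * q k (ww j - ww k) (ww j - ww k)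
    + 2 * (tau j - tau k) * L k (ww j - ww k) + (tau j - tau k) ^+ 2 * g k = 0.
  have : F (pp k) (uu j - uu k) (uu j - uu k) = 0.
    move: (uu j) (uu k) (H1 j (pp k)) (H2 k) => x x' h1 h2.
    by rewrite /F !triE (tri_sym _ x x' sB) -!/(F _ _ _) h1 !h2; ring.
  have -> : uu j - uu k = iota (ww j - ww k) + (tau j - tau k) *: e2.
    rewrite /uu iD iN scalerBl; move: (iota (ww j)) (iota (ww k)) => x x'.
    by rewrite !opprD addrACA [x + e1 + _]addrACA subrr addr0.
  rewrite /F !triE -!/(F _ _ _) Fb -/(q _ _ _) [F _ e2 (iota _)]Fsym.
  rewrite -/(L _ _) -/(g _) => <-; ring.
have ww0 : ww k0 = 0 by rewrite /ww scaler0.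
have tau0 : tau k0 = 0 by rewrite /tau eqxx.
have tau_neq0 k : k != k0 -> tau k != 0 by move=> h; rewrite -tau0 (inj_eq tau_inj).
(* At [k0] both [tau] and [ww] vanish, so [R] is divisible by the square of [tau j]. *)
have R0 j : j != k0 -> c * q k0 (zz j) (zz j) + 2 * L k0 (zz j) + g k0 = 0.
  move=> /tau_neq0 nj; have := R k0 j; rewrite ww0 tau0 !subr0 /ww /q !triE LZ => e.
  apply: (mulfI nj); apply: (mulfI nj); rewrite !mulr0 -[RHS]e.
  ring.
have Fe1 k u : F (pp k) (iota u) e1 = - c * q k u (ww k) - tau k * L k u.
  have := H2 k (iota u); rewrite Fsym /uu /F !triE -!/(F _ _ _) Fb -/(L _ _) -/(q _ _ _) => e.
  apply/eqP; rewrite -subr_eq0 -[X in _ == X]e; apply/eqP; ring.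
(* Singularity at the base point [i], tested against [e2] and then [e1], and split along the two
   summands of [e_ i]. *)
have S (k k' : TI) i : e_ i = pp k + pp k' ->
    L k (f_ i) + L k' (f_ i) = 0 /\
    c * (q k (f_ i) (ww k) + q k' (f_ i) (ww k')) + tau k * L k (f_ i)
      + tau k' * L k' (f_ i) = 0.
  move=> ei; have := G2 i e2; have := G2 i e1; rewrite ei /F !triE -!/(F _ _ _) !Fe1.
  by rewrite -!/(L _ _) => h ->; split=> //; rewrite -[RHS]oppr0 -[in RHS]h; ring.
pose j1 : TI := inl (inr false); pose j2 : TI := inl (inr true).
pose j5 : TI := inr (a0, false).
have Epp i : e_ (inl i) = pp k0 + pp (inl (inr i)) by rewrite /= addrC subrK.
have Eqa a : e_ (inr a) = pp (inr (a, false)) + pp (inr (a, true)).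
  by rewrite /= addrC subrK.
have gb i z : tri b (e_ i) (f_ i) z = 0 by exact: (hb i).2.
have qk0 i z : q (inl (inr i)) (f_ (inl i)) z = - q k0 (f_ (inl i)) z.
  by rewrite /q /= triE gb add0r triE.
have Lk0 i : L k0 (f_ (inl i)) = - c * q k0 (f_ (inl i)) (zz (inl (inr i))).
  have [e e'] := S _ _ _ (Epp i).
  have nj : tau (inl (inr i)) != 0 by apply: tau_neq0.
  move: e'; rewrite ww0 tau0 /q tri03 -!/(q _ _ _) /ww [q _ _ _]triZ3 -!/(q _ _ _) qk0.
  move: e => /eqP; rewrite addrC addr_eq0 => /eqP -> e.
  apply: (mulfI nj); apply/eqP; rewrite -subr_eq0 -oppr_eq0 -[X in _ == X]e.
  apply/eqP; ring.
have zz5 : zz j5 = f_ iF - y by rewrite /= eqxx.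
(* [R0] at [j2] gives [g k0 = 0]. Adding [R0] at [j1] and [j5], where [y] enters with opposite
   signs, removes [L k0 y] and leaves a multiple of [c] times the scalar of [by0]. *)
have cb : c *: b = 0.
  have [->|nb] := eqVneq b 0; first by rewrite scaler0.
  have R1 := R0 j1 isT; have R2 := R0 j2 isT; have R5 := R0 j5 isT.
  have L1 := Lk0 false; have L2 := Lk0 true.
  move: R1 R2 R5 L1 L2; rewrite zz5 /= -/iF -/iT /q !triE !(LD, LN) !G1.
  rewrite (tri_sym _ (f_ iF) y sb) => R1 R2 R5 L1 L2.
  have /eqP : c * (2 * tri b p y (f_ iF) - tri b p y y) = 0.
    move: R1 R2 R5 L1 L2.
    move: (tri b p y (f_ iF)) (tri b p y y) (L _ (f_ iF)) (L _ y) (L _ (f_ iT)) (g k0).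
    move=> x1 x2 x3 x4 x5 x6 R1 R2 R5 L1 L2.
    have {}L2 : x5 = 0 by rewrite L2; ring.
    have {}R2 : x6 = 0 by rewrite -R2 L2; ring.
    have /= h := congr2 (fun u v => - (u + v)) R1 R5.
    have {}h : c * (2 * x1 - x2) * 2 = - (0 + 0) by rewrite -h R2 L1; ring.
    by apply: (mulIf (_ : 2 != 0)); rewrite ?pnatr_eq0 // h; ring.
  by rewrite mulf_eq0 (negbTE (by0 nb)) orbF => /eqP->; rewrite scale0r.
have cq v u w : c * tri b v u w = 0.
  by rewrite -[c * _]addr0 -(tri0t v u w) -tri_linear0 cb addr0.
have Rk k j : 2 * L k (ww j - ww k) + (tau j - tau k) * g k = 0.
  have [->|njk] := eqVneq j k.
    by rewrite !subrr LZ0 mulr0 mul0r addr0.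
  have nt : tau j - tau k != 0 by rewrite subr_eq0 (inj_eq tau_inj).
  apply: (mulfI nt); rewrite mulr0 -[RHS](R k j) cq; ring.
(* The difference of the relations [Rk] for [j] and for [k0] is divisible by [tau j]. *)
have Lz k j : j != k0 -> 2 * L k (zz j) = - g k.
  move=> /tau_neq0 nj; have := Rk k j; have := Rk k k0.
  rewrite ww0 tau0 !sub0r LD !LN /ww !LZ => h h'.
  have /= e := congr2 (fun u v => u - v) h' h.
  apply: (mulfI nj); apply/eqP; rewrite -subr_eq0; apply/eqP.
  by transitivity (0 - 0 : K); [rewrite -e|]; ring.
have two : (2 : K) != 0 by rewrite pnatr_eq0.
(* For [iF], use that it is half the sum of [zz j1] and [zz j5]. *)
have Lf k i : 2 * L k (f_ i) = - g k.
  case: i => [[]|a]; first exact: (Lz k j2); last exact: (Lz k (inr (a, true))).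
  have := Lz k j5 isT; have := Lz k j1 isT; rewrite zz5 /= !(LD, LN) -/iF => h h'.
  have /= e := congr2 (fun u v => u + v) h' h.
  by apply: (mulfI two); transitivity (- g k + - g k); [rewrite -e|]; ring.
have Ly k : L k y = 0.
  have := Lz k j1 isT; rewrite /= LD mulrDr Lf => /eqP; rewrite -subr_eq0 addrAC subrr add0r.
  by rewrite mulf_eq0 (negbTE two) => /eqP.
(* [S] is now a homogeneous 2 by 2 system whose determinant is, up to sign, the difference of two
   values of [tau]. *)
have pair0 k k' i : k != k' -> e_ i = pp k + pp k' -> g k = 0 /\ g k' = 0.
  move=> nkk /S[]; rewrite mulrDr !cq addr0 add0r => h h'.
  have nt : tau k - tau k' != 0 by rewrite subr_eq0 (inj_eq tau_inj).
  have Lk : L k (f_ i) = 0.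
    have /= e := congr2 (fun u v => u - tau k' * v) h' h.
    by apply: (mulfI nt); transitivity (0 - tau k' * 0); [rewrite -e|]; ring.
  move: h; rewrite Lk add0r => Lk'.
  by split; apply/eqP; rewrite -oppr_eq0 -(Lf _ i) ?Lk ?Lk' mulr0.
have nab a : inr (a, false) != inr (a, true) :> TI by apply/eqP.
have g0 k : g k = 0.
  case: k => [[[]|i]|[a []]].
  - exact: (pair0 k0 j1 iF isT (Epp false)).1.
  - exact: (pair0 k0 (inl (inr i)) (inl i) isT (Epp i)).2.
  - exact: (pair0 _ _ (inr a) (nab a) (Eqa a)).2.
  - exact: (pair0 _ _ (inr a) (nab a) (Eqa a)).1.
(* [L k] kills all basis vectors except possibly [inr a0], and it kills [y], whose coordinate there
   is nonzero. *)
have L0 k u : L k u = 0.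
  have Ld x : x != inr a0 -> L k (d x) = 0.
    case: x => [i|a] h; apply: (mulfI two); rewrite mulr0.
      by rewrite [2 * _]Lf g0 oppr0.
    have := Lz k (inr (a, false)) isT; rewrite /= g0 oppr0; case: eqP => // aa.
    by rewrite aa eqxx in h.
  have Lv v : L k v = v (inr a0) * L k (d (inr a0)).
    rewrite [in LHS](vec_delta v) (bigD1 (inr a0)) //= LD LZ -[RHS]addr0; congr (_ + _).
    elim/big_rec: _ => [|i w ix IH]; first by rewrite /L i0 /F tri02.
    by rewrite LD LZ Ld // mulr0 add0r.
  rewrite Lv; move: (Lv y); rewrite Ly => /esym/eqP.
  by rewrite mulf_eq0 (negbTE y0) => /eqP ->; rewrite mulr0.
have Fe2 k w : F (pp k) e2 (iota w) = 0 by rewrite Fsym [LHS]L0.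
(* Singularity at the point [k] solved for its [e1] component. *)
have F1 k z : F (pp k) e1 z = - F (pp k) (iota (ww k)) z - tau k * F (pp k) e2 z.
  by apply/eqP; rewrite -subr_eq0 -[X in _ == X](H2 k z) /uu /F !triE; apply/eqP; ring.
have Fii k u w : F (pp k) (iota u) (iota w) = 0 by rewrite Fb cq.
have F1i k w : F (pp k) e1 (iota w) = 0 by rewrite F1 Fii Fe2 mulr0 subr0 oppr0.
have F12 k : F (pp k) e1 e2 = 0.
  by rewrite F1 [F _ e2 e2]g0 [F _ _ e2]L0 mulr0 subr0 oppr0.
have F11 k : F (pp k) e1 e1 = 0.
  by rewrite F1 [F _ (iota _) _]Fsym F1i [F _ e2 _]Fsym F12 mulr0 subr0 oppr0.
have Fpp k x x' : F (pp k) (d x) (d x') = 0.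
  have dl (w : WI) : d (inl w : WI + bool) = iota (d w) by rewrite /iota push_delta.
  case: x => [w|[]]; case: x' => [w'|[]]; rewrite ?dl -?/e1 -?/e2 ?Fii //.
  - exact: L0.
  - by rewrite Fsym.
  - exact: g0.
  - by rewrite Fsym.
apply/ffunP => -[[k x] x']; rewrite -tri_delta ffunE.
apply: (pp_span (psi := fun v => tri B v (d x) (d x'))) => [a u v|k']; first exact: tri_linear1.
exact: Fpp.
Qed.

End Configuration.

(** The requirements on [p] and [y] are open and separately satisfiable, hence jointly
    satisfiable. *)
Lemma killing_ex b : residual b -> exists P, killing b P.
Proof.
move=> rb; have [sb hb] := rb.
pose X (P : TI + WI -> K) := xpart P; pose Y (P : TI + WI -> K) := ypart P.
have o1 : line_open (fun P : TI + WI -> K => P (inl k0) * P (inr (inr a0)) != 0).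
  apply: line_open_neq0 => P Q; apply: polyfunM; exact: polyfun_line.
have e1 : exists P : TI + WI -> K, P (inl k0) * P (inr (inr a0)) != 0.
  by exists (fun=> 1); rewrite mulr1 oner_eq0.
have [b0|nb] := eqVneq b 0.
  have [P] := e1; rewrite mulf_eq0 negb_or => /andP[Pk Pa].
  eexists; apply: (configuration_killing rb (p := X P) (y := Y P)) => //.
  by rewrite b0 eqxx.
pose G P := 2 * tri b (X P) (Y P) (f_ iF) - tri b (X P) (Y P) (Y P).
have o2 : line_open (fun P => G P != 0).
  apply: line_open_neq0 => P Q; apply: polyfunD.
    apply: polyfunM; first exact: polyfun_cst.
    apply: polyfun_tri => i; [exact: polyfun_line|exact: polyfun_line|exact: polyfun_cst].
  under [X in polyfun X]eq_fun do rewrite -mulN1r.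
  apply: polyfunM; first exact: polyfun_cst.
  by apply: polyfun_tri => i; exact: polyfun_line.
(* The values of [G] at [y] and [- y] add up to minus twice [tri b v y y], so one of them is
   nonzero. *)
have e2 : exists P, G P != 0.
  have [v [y vy]] := tri_polarize sb nb.
  have G1 : G (point v y) = 2 * tri b v y (f_ iF) - tri b v y y by [].
  have G2 : G (point v (- y)) = - (2 * tri b v y (f_ iF)) - tri b v y y.
    by rewrite /G /X /Y [ypart _](_ : _ = - y) // !triE; ring.
  have [g1|] := eqVneq (G (point v y)) 0; last by exists (point v y).
  exists (point v (- y)); apply: contra vy => /eqP g2.
  suff /eqP : tri b v y y * 2 = 0 by rewrite mulf_eq0 pnatr_eq0 orbF.
  by rewrite -[RHS]oppr0 -[in RHS](addr0 0) -[X in - (X + _)]g1 -g2 G1 G2; ring.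
have [P [P1 P2]] := line_open_meet o1 o2 e1 e2.
move: P1; rewrite mulf_eq0 negb_or => /andP[Pk Pa].
by eexists; apply: (configuration_killing rb (p := X P) (y := Y P)).
Qed.

End Block.

(** * Choice of the blocks *)

Section Greedy.
Variables (K : numFieldType) (A : finType) (a0 : A).

Let GI : finType := (bool + A)%type.
Let TI : finType := ((unit + bool) + A * bool)%type.
Let WI : finType := ((bool + A) + A)%type.
Let UI : finType := (WI + bool)%type.

Notation d := (@delta K _).
Notation block := (TI * (TI + UI) -> K).

Let next (k : TI) : TI :=
  match k with
  | inl (inl _) => inl (inr false)
  | inl (inr false) => inl (inr true)
  | inl (inr true) => inl (inl tt)
  | inr (a, c) => inr (a, ~~ c)
  end.

(* The blocks e_k and e_k + e_(next k), where [next] has no fixed point. *)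
Lemma transverse_ex : exists Q P : block, transverse P Q.
Proof.
have next_inj : injective next by do 2![case=> [[[]|[]]|[? []]]] => //= -[->].
have next_neq k : next k != k by case: k => [[[]|[]]|[a []]]; apply/eqP.
pose u (k : TI) : bool -> K^o := d false + (enum_rank k)%:R *: d true.
pose P (x : TI -> TI -> K^o) (t : TI * (TI + UI)) : K :=
  match t.2 with
  | inl i => x t.1 i | inr (inl _) => 0 | inr (inr c) => u t.1 c
  end.
exists (P (fun k => d k + d (next k))), (P d) => C hP hQ.
have {}hP k z : tri C (d k) (u k) z = 0 by exact: (hP k z).
have {}hQ k z : tri C (d k + d (next k)) z (u k) = 0 by exact: (hQ k z).
have rk (k l : TI) : k != l -> ((enum_rank k)%:R - (enum_rank l)%:R : K) != 0.
  by rewrite subr_eq0 eqr_nat => h; apply: contra h => /eqP/val_inj/enum_rank_inj->.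
have two_u (psi : (bool -> K^o) -> K) k l : k != l ->
    (forall a x y, psi (a *: x + y) = a * psi x + psi y) ->
    psi (u k) = 0 -> psi (u l) = 0 -> forall c, psi (d c) = 0.
  move=> kl psiL; rewrite /u [d false + _]addrC [d false + _]addrC !psiL => hk hl.
  have dt : psi (d true) = 0.
    have /= e := congr2 (fun x y => x - y) hk hl.
    by apply: (mulfI (rk _ _ kl)); transitivity (0 - 0 : K); [rewrite -e|]; ring.
  by case=> //; move: hk; rewrite dt mulr0 add0r.
(* In the middle slot both [u (next k)] and [u k] give 0, and they span the plane. *)
have h1 k c : tri C (d (next k)) (d c) (u k) = 0.
  apply: (two_u (fun x => tri C (d (next k)) x (u k)) _ _ (next_neq k)) => //.
  - by move=> *; exact: tri_linear2.
  - by have := hQ k (u k); rewrite triD1 hP add0r.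
have h2 k c : tri C (d k) (d c) (u k) = 0.
  by have := hQ k (d c); rewrite triD1 h1 addr0.
apply/ffunP => -[[k c] c']; rewrite -tri_delta ffunE.
have [prev nextK prevK] := injF_bij next_inj.
(* In the last slot [u k] gives 0 by [h2] and [u (prev k)] by [h1]. *)
apply: (two_u (fun x => tri C (d k) (d c) x) k (prev k)) => //.
- by rewrite -{1}[k]prevK next_neq.
- by move=> *; exact: tri_linear3.
- by rewrite -{1}[k]prevK h1.
Qed.

Definition extends (P : block) (b : tensor K TI WI WI) : Prop :=
  exists B : tensor K TI UI UI, [/\ symmetric_tensor B, pull id inl inl B = b,
    forall i, singular B (base_point K inl i) & forall k, singular B (fun i => P (k, i))].

Lemma extends_subspace P : subspace (extends P).
Proof.
split.
  exists 0; split; first by case: (symmetric_subspace K TI UI).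
  - by apply/ffunP => t; rewrite !ffunE.
  - by move=> i; exact: (singular_subspace _).1.
  - by move=> i; exact: (singular_subspace _).1.
move=> c b b' [B [s1 e1 h1 g1]] [B' [s2 e2 h2 g2]]; exists (c *: B + B'); split.
- exact: (symmetric_subspace _ _ _).2.
- by rewrite -e1 -e2; apply/ffunP => t; rewrite !ffunE.
- by move=> i; apply: (singular_subspace _).2.
- by move=> i; apply: (singular_subspace _).2.
Qed.

Lemma residual_subspace : subspace (@residual K A).
Proof.
split.
  split; first by case: (symmetric_subspace K TI WI).
  by move=> i; exact: (singular_subspace _).1.
move=> c b b' [s1 h1] [s2 h2]; split; first exact: (symmetric_subspace _ _ _).2.
by move=> i; apply: (singular_subspace _).2.
Qed.

Lemma common_extension_subspace (th : nat -> block) t :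
  subspace (fun b => @residual K A b /\ forall i, (i < t)%N -> extends (th i) b).
Proof.
split.
  by split=> [|i _]; [exact: residual_subspace.1 | exact: (extends_subspace _).1].
move=> c b b' [r1 h1] [r2 h2]; split; first exact: residual_subspace.2.
by move=> i it; apply: (extends_subspace _).2; [exact: h1|exact: h2].
Qed.

Lemma killing_extends (b : tensor K TI WI WI) P : killing b P -> extends P b -> b = 0.
Proof.
move=> kb [B [sB pB gB hB]]; rewrite -pB.
suff -> : B = 0 by apply/ffunP => t; rewrite !ffunE.
by apply: kb => //; split=> //; exists 1; rewrite scale1r.
Qed.

Lemma killing0 (b : tensor K TI WI WI) P : killing b P -> killing 0 P.
Proof.
move=> kb B [sB [c pB] gB] hB; apply: kb => //; split=> //.
by exists 0; rewrite pB scaler0 scale0r.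
Qed.

(** The existence of a partner [P] in the first clause is carried along so that the next block can
    be made transverse to all earlier ones. *)
Lemma blocks_ex (D : nat) :
    (forall Y : {vspace tensor K TI WI WI},
      (forall b, b \in Y -> residual b) -> (\dim Y <= D)%N) ->
  forall t, exists th : nat -> block,
  [/\ forall i, (i < t)%N -> killing 0 (th i) /\ exists P, transverse P (th i),
      forall i j, (i < j < t)%N -> transverse (th j) (th i) &
      forall Y : {vspace tensor K TI WI WI},
        (forall b, b \in Y -> residual b /\ forall i, (i < t)%N -> extends (th i) b) ->
      (\dim Y <= D - t)%N].
Proof.
move=> dimD; elim=> [|t [th [th1 th2 th3]]].
  exists (fun _ _ => 0); split=> // [i j|Y hY]; first by rewrite ltn0 andbF.
  by rewrite subn0; apply: dimD => b /hY[].
have /subspace_vspace[Y hY] := common_extension_subspace th t.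
(* A nonzero common extendable form, or 0 once none is left; a killing block exists in both
   cases. *)
pose b := vpick Y.
have [rb hb] := (hY b).1 (memv_pick Y).
have [|||P [Pb PQ] Pth] := @line_open_meet_seq _ _ _ (iota 0 t) (fun i P => transverse P (th i))
   (fun P => killing b P /\ exists Q, transverse Q P).
- apply: line_openI; last exact: line_open_transverse_r.
  exact/line_open_nonsingular/extension_subspace.
- apply: line_open_meet.
  + exact/line_open_nonsingular/extension_subspace.
  + exact: line_open_transverse_r.
  + exact: (killing_ex a0 rb).
  + exact: transverse_ex.
- move=> i; rewrite mem_iota add0n => /andP[_ it]; split; last exact: (th1 i it).2.
  exact: line_open_transverse_l.
exists (fun i => if (i < t)%N then th i else P); split.
- move=> i it; case: ifP => it'; first exact: th1.
  by split; [exact: killing0 Pb|].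
- move=> i j /andP[ij]; rewrite ltnS => jt; rewrite (leq_trans ij jt).
  case: ifP => jt'; first by apply: th2; rewrite ij jt'.
  by apply: Pth; rewrite mem_iota add0n (leq_trans ij jt).
move=> Z hZ.
have ZY : (Z <= Y)%VS.
  apply/subvP => c /hZ[rc hc]; apply/hY; split=> // i it.
  by have := hc i (leqW it); rewrite it.
have dY : (\dim Y <= D - t)%N by apply: th3 => c /hY.
have [Y0|nY] := eqVneq b 0.
  have /eqP := Y0; rewrite vpick0 => /eqP Y00; move: ZY; rewrite Y00 subv0 => /eqP ->.
  by rewrite dimv0.
suff : (\dim Z < \dim Y)%N by move: dY; lia.
rewrite ltn_neqAle dimvS // andbT; apply: contra nY => e.
have bZ : b \in Z.
  have /eqP -> : (Z == Y)%VS by rewrite eqEdim ZY (eqP e) leqnn.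
  exact: memv_pick.
have [_ /(_ t (ltnSn t))] := hZ b bZ; rewrite ltnn => /killing_extends -> //.
Qed.

(** * Vanishing of a form on W from its components *)

Section Assembly.
Variables (t : nat) (th : nat -> block).
Hypothesis th1 : forall i, (i < t)%N -> killing 0 (th i).
Hypothesis th2 : forall i j, (i < j < t)%N -> transverse (th j) (th i).
Hypothesis th3 : forall b, residual b ->
  (forall i, (i < t)%N -> extends (th i) b) -> b = 0.

Let FI : finType := (WI + 'I_t * bool)%type.

Definition block_embed (i : 'I_t) (x : UI) : FI :=
  match x with inl w => inl w | inr c => inr (i, c) end.

Definition block_point (i : 'I_t) (k : TI) : TI + FI -> K :=
  point (fun l => th i (k, inl l)) (push (block_embed i) (fun x => th i (k, inr x))).

Lemma assembled_eq0 (B : tensor K TI FI FI) :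
    symmetric_tensor B -> (forall i, singular B (base_point K inl i)) ->
    (forall i k, singular B (block_point i k)) ->
  B = 0.
Proof.
move=> sB gB hB.
pose Bi i := pull id (block_embed i) (block_embed i) B.
pose b : tensor K TI WI WI := pull id inl inl B.
have sBi i : symmetric_tensor (Bi i) by move=> k x y; rewrite !ffunE sB.
have gBi i j : singular (Bi i) (base_point K inl j).
  have e : ypart (base_point K (inl : WI -> FI) j) =
           push (block_embed i) (ypart (base_point K (inl : WI -> UI) j)).
    by rewrite [RHS]push_delta.
  split=> z; rewrite -tri_push push_id -e; [exact: (gB j).1 | exact: (gB j).2].
have hBi i k : singular (Bi i) (fun x => th i (k, x)).
  split=> z; rewrite -tri_push push_id; [exact: (hB i k).1 | exact: (hB i k).2].
have b0 : b = 0.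
  apply: th3.
    split=> [k x y|j]; first by rewrite !ffunE sB.
    have e : ypart (base_point K (inl : WI -> FI) j) =
             push inl (ypart (base_point K id j : TI + WI -> K)).
      by rewrite [RHS]push_delta.
    split=> z; rewrite -tri_push push_id -e; [exact: (gB j).1 | exact: (gB j).2].
  move=> i it; exists (Bi (Ordinal it)); split=> //.
    by apply/ffunP => x; rewrite !ffunE.
have Bi0 i : Bi i = 0.
  apply: (th1 (ltn_ord i)); last exact: hBi.
  split; [exact: sBi | exists 0 | exact: gBi].
  by rewrite scale0r -b0; apply/ffunP => x; rewrite !ffunE.
have B0 i k x y : B (k, block_embed i x, block_embed i y) = 0.
  by have /ffunP/(_ (k, x, y)) := Bi0 i; rewrite !ffunE.
pose C i j : tensor K TI bool bool :=
  pull id (fun c => inr (i, c)) (fun c => inr (j, c)) B.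
(* The components pairing W_0 with the plane of block [j] are already zero, so for test vectors in
   that plane only the plane coordinates of the point contribute. *)
have hC i j k z :
    tri (C i j) (fun l => th i (k, inl l)) (fun c => th i (k, inr (inr c))) z = 0.
  have := (hB i k).2 (push (fun c => inr (j, c)) z).
  rewrite -[xpart _]push_id tri_push /tri => h; rewrite -[RHS]h.
  pose Z (x : UI) l c' := B (l, block_embed i x, inr (j, c')) *
    (th i (k, inl l) * th i (k, inr x) * z c').
  transitivity (\sum_l \sum_c \sum_c' Z (inr c) l c').
    rewrite pair_big /= pair_big /=; apply: eq_bigr => -[[l c] c'] _ /=.
    by rewrite ffunE.
  transitivity (\sum_l \sum_x \sum_c' Z x l c'); last first.
    rewrite pair_big /= pair_big /=; apply: eq_bigr => -[[l c] c'] _ /=.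
    by rewrite ffunE.
  apply: eq_bigr => l _; rewrite [RHS]big_sumType /= [X in _ = X + _]big1 ?add0r //.
  by move=> w _; rewrite big1 // => c' _; rewrite /Z [B _](B0 j l (inl w) (inr c')) mul0r.
(* By symmetry of [B], [C j i] is the transpose of [C i j], so block [i] annihilates its last
   slot. *)
have C0 (i j : 'I_t) : (i < j)%N -> C j i = 0.
  move=> ij; apply: (th2 (i := i) (j := j)); first by rewrite ij ltn_ord.
    by move=> k z; exact: hC.
  move=> k z; rewrite -[RHS](hC i j k z) -tri_swap; congr (tri _ _ _ _).
  by apply/ffunP => -[[l c] c']; rewrite !ffunE sB.
have Cij i j k c c' : B (k, inr (i, c), inr (j, c')) = 0.
  case: (ltngtP i j) => [ij|ji|/val_inj->]; last exact: (B0 j k (inr c) (inr c')).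
    by rewrite sB; have /ffunP/(_ (k, c', c)) := C0 _ _ ij; rewrite !ffunE.
  by have /ffunP/(_ (k, c, c')) := C0 _ _ ji; rewrite !ffunE.
apply/ffunP => -[[k [w|[i c]]] [w'|[j c']]]; rewrite [RHS]ffunE.
- by have /ffunP/(_ (k, w, w')) := b0; rewrite !ffunE.
- exact: (B0 j k (inl w) (inr c')).
- exact: (B0 i k (inr c) (inl w')).
- exact: Cij.
Qed.

End Assembly.

(** * Dimension of K_0 *)

Lemma dim_le_card (E : vectType K) (Y : {vspace E}) (C : finType) (phi : C -> E -> K) :
    (forall c a u v, phi c (a *: u + v) = a * phi c u + phi c v) ->
    (forall v, v \in Y -> (forall c, phi c v = 0) -> v = 0) ->
  (\dim Y <= #|C|)%N.
Proof.
move=> phiL /(injective_minor Y phiL)[g det_g].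
rewrite -[leqLHS]card_ord; apply: (@leq_card _ _ g) => i j gij.
apply: contraNeq det_g => ij; rewrite -det_tr.
by apply/eqP/(determinant_alternate ij) => l; rewrite !mxE gij.
Qed.

(* Indices of the coordinates that do not vanish identically on [residual]. *)
Let free (k : TI) (x y : WI) : bool :=
  match x, y with
  | inl i, inl j => [&& i != j, k != base_index i & k != base_index j]
  | inl i, inr _ | inr _, inl i => k != base_index i
  | inr _, inr _ => true
  end.

Lemma residual_not_free (b : tensor K TI WI WI) k x y :
  residual b -> ~~ free k x y -> b (k, x, y) = 0.
Proof.
move=> [sb hb].
have h1 i k' : b (k', inl i, inl i) = 0.
  by rewrite -tri_delta; exact: (hb i).1.
have h2 i y' : b (base_index i, inl i, y') = 0.
  by rewrite -tri_delta; exact: (hb i).2.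
case: x => [i|a]; case: y => [j|a'] //=.
- rewrite !negb_and !negbK => /or3P[/eqP->|/eqP->|/eqP->]; first exact: h1.
    exact: h2.
  by rewrite sb h2.
- by rewrite negbK => /eqP->; exact: h2.
- by rewrite negbK sb => /eqP->; exact: h2.
Qed.

(** The half sum and its mirror image cover every pair once, except that the diagonal occurs in
    both. *)
Lemma sum_ordered_pairs (I : finType) (F : I -> I -> nat) :
    (forall x y, F x y = F y x) ->
  (2 * (\sum_x \sum_(y | enum_rank x <= enum_rank y) F x y)
   = \sum_x \sum_y F x y + \sum_x F x x)%N.
Proof.
move=> Fsym; rewrite mul2n -addnn.
have -> : (\sum_x \sum_(y | enum_rank x <= enum_rank y) F x y
   + \sum_x \sum_(y | enum_rank x <= enum_rank y) F x y
   = \sum_x \sum_(y | enum_rank x <= enum_rank y) F x y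
   + \sum_x \sum_(y | enum_rank y <= enum_rank x) F x y)%N.
  congr (_ + _)%N; rewrite (exchange_big_dep xpredT) //=.
  by apply: eq_bigr => x _; apply: eq_bigr => y _.
rewrite -!big_split /=; apply: eq_bigr => x _.
rewrite big_mkcond /= [X in (_ + X)%N]big_mkcond /= -big_split /=.
rewrite (bigD1 x) //= [in RHS](bigD1 x) //= leqnn addnAC; congr (_ + _ + _)%N.
apply: eq_bigr => y yx; case: ltngtP; rewrite ?addn0 ?add0n //.
by move=> /val_inj/enum_rank_inj e; rewrite e eqxx in yx.
Qed.

(** By symmetry the free coordinates with [x] ranked no later than [y] determine a form. With q the
    cardinality of [A], a pair of distinct base indices leaves 2q+1 values of [k], a mixed pair
    2q+2, and a pair without base index 2q+3. The factor 2 avoids halves. *)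
Lemma residual_dim (Y : {vspace tensor K TI WI WI}) :
    (forall b, b \in Y -> residual b) ->
  (2 * \dim Y <= #|A|.+2 * #|A|.+1 * (2 * #|A| + 1)
     + 2 * (#|A|.+2 * #|A| * (2 * #|A| + 2))
     + #|A| * #|A| * (2 * #|A| + 3) + #|A| * (2 * #|A| + 3))%N.
Proof.
move=> hY; set q := #|A|.
pose S := [pred s : TI * WI * WI | free s.1.1 s.1.2 s.2 && (enum_rank s.1.2 <= enum_rank s.2)%N].
pose N x y := #|[pred k | free k x y]|.
have freeC k x y : free k x y = free k y x.
  case: x => [i|a]; case: y => [j|a'] //=.
  by rewrite eq_sym [X in _ && X]andbC.
have cardT : #|{: TI}| = (2 * q + 3)%N.
  by rewrite !card_sum card_prod card_unit card_bool /q; lia.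
have base_inj : injective (@base_index A) by case=> [?|?] [?|?] //= [->].
have N1 i a : N (inl i) (inr a) = (2 * q + 2)%N.
  have := cardC (pred1 (base_index i)); rewrite card1 cardT => h.
  apply: (@addnI 1); transitivity (2 * q + 3)%N; last by lia.
  by rewrite -h; congr (_ + _)%N; apply: eq_card.
have N2 i j : N (inl i) (inl j) = ((i != j) * (2 * q + 1))%N.
  rewrite /N /=; have [->|nij] /= := eqVneq i j.
    by rewrite mul0n; apply: eq_card0.
  have := cardC (pred2 (base_index i) (base_index j)).
  rewrite card2 (inj_eq base_inj) nij cardT /= mul1n => h.
  apply: (@addnI 2); transitivity (2 * q + 3)%N; last by lia.
  rewrite -h; congr (_ + _)%N; apply: eq_card => k.
  by rewrite !inE /= negb_or.
have N3 a a' : N (inr a) (inr a') = (2 * q + 3)%N by rewrite -cardT.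
have Nsym x y : N x y = N y x by apply: eq_card => k; rewrite !inE freeC.
have cS : #|S| = (\sum_x \sum_(y | enum_rank x <= enum_rank y) N x y)%N.
  rewrite -[LHS]sum1_card [RHS]pair_big_dep /=.
  transitivity (\sum_(s : WI * WI | enum_rank s.1 <= enum_rank s.2)
      \sum_(k | free k s.1 s.2) 1)%N; last by apply: eq_bigr => s _; rewrite sum1_card.
  rewrite pair_big_dep /= (reindex (fun s : WI * WI * TI => (s.2, s.1.1, s.1.2))) /=.
    by apply: eq_bigl => s; rewrite !inE /= andbC.
  by exists (fun s : TI * WI * WI => (s.1.2, s.2, s.1.1)) => -[[]].
have cG : #|{: GI}| = q.+2 by rewrite card_sum card_bool.
have : (\dim Y <= #|{: {s | S s}}|)%N.
  apply: (@dim_le_card _ Y _ (fun s b => b (val s))) => [s c u v|b /hY rb h].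
    by rewrite !ffunE.
  have hf k x y : (enum_rank x <= enum_rank y)%N -> b (k, x, y) = 0.
    move=> xy; have [f|] := boolP (free k x y); last exact: residual_not_free.
    have Ss : S (k, x, y) by rewrite /= f.
    by have := h (exist _ (k, x, y) Ss).
  apply/ffunP => -[[k x] y]; rewrite [RHS]ffunE.
  have [sb _] := rb; have [xy|/ltnW yx] := leqP (enum_rank x) (enum_rank y).
    exact: hf.
  by rewrite sb; exact: hf.
rewrite card_sig cS -(leq_pmul2l (isT : 0 < 2)%N) sum_ordered_pairs //.
move=> /leq_trans; apply.
have sumG (F : GI -> nat) c : (forall i, F i = c) -> (\sum_i F i = q.+2 * c)%N.
  by move=> h; rewrite (eq_bigr (fun=> c)) // sum_nat_const -cG.
have sumA (F : A -> nat) c : (forall i, F i = c) -> (\sum_i F i = q * c)%N.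
  by move=> h; rewrite (eq_bigr (fun=> c)) // sum_nat_const.
have s1 i : (\sum_y N (inl i) y = q.+1 * (2 * q + 1) + q * (2 * q + 2))%N.
  rewrite big_sumType /= (sumA _ _ (N1 i)); congr (_ + _)%N.
  rewrite (bigD1 i) //= N2 eqxx mul0n add0n.
  rewrite (eq_bigr (fun=> 2 * q + 1)%N); last first.
    by move=> j ji; rewrite N2 eq_sym ji mul1n.
  rewrite sum_nat_const; congr (_ * _)%N.
  by rewrite -[q.+1]/(q.+2.-1) -cG -(cardC1 i); apply: eq_card => j; rewrite !inE.
have s2 a : (\sum_y N (inr a) y = q.+2 * (2 * q + 2) + q * (2 * q + 3))%N.
  rewrite big_sumType /= (sumA _ _ (N3 a)); congr (_ + _)%N.
  by apply: sumG => i; rewrite Nsym N1.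
rewrite big_sumType /= (sumG _ _ s1) (sumA _ _ s2) big_sumType /=.
rewrite [X in (_ + (X + _))%N]big1 ?add0n; last by move=> i _; rewrite N2 eqxx.
rewrite (sumA _ _ (fun a => N3 a a)).
by move: (q) => x; apply: eq_leq; ring.
Qed.

End Greedy.

(** * Passage to polynomials and general points *)

Section WeightedHomogeneous.
Variables (K : fieldType) (N : nat) (w : 'X_{1..N} -> nat).
Hypotheses (w0 : w 0%MM = 0%N) (wD : forall a b, w (a + b)%MM = (w a + w b)%N).

(** The weight [w] will be the degree in the x- or y-coordinates of a single point. *)
Definition whomog (d : nat) (F : {mpoly K[N]}) : Prop := forall a, a \in msupp F -> w a = d.

Lemma whomogM d e F G : whomog d F -> whomog e G -> whomog (d + e) (F * G).
Proof.
by move=> hF hG a /msuppM_le/allpairsP[[b c] /= [/hF <- /hG <- ->]]; rewrite wD.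
Qed.

Lemma whomogZ d c F : whomog d F -> whomog d (c *: F).
Proof. by move=> hF a /msuppZ_le/hF. Qed.

Lemma whomog_sum d (I : Type) (r : seq I) (P : pred I) (F : I -> {mpoly K[N]}) :
  (forall i, whomog d (F i)) -> whomog d (\sum_(i <- r | P i) F i).
Proof.
move=> hF; apply: big_rec => [a|i G _ hG a]; first by rewrite msupp0.
by move=> /msuppD_le; rewrite mem_cat => /orP[/hF|/hG].
Qed.

Lemma whomog_prod (I : Type) (r : seq I) (P : pred I) (F : I -> {mpoly K[N]}) (d : I -> nat) :
  (forall i, whomog (d i) (F i)) ->
  whomog (\sum_(i <- r | P i) d i) (\prod_(i <- r | P i) F i).
Proof.
move=> hF; elim/big_rec2: _ => [a|i G e _ hG]; last exact: whomogM.
by rewrite msupp1 inE => /eqP->.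
Qed.

Lemma whomog_det p (M : 'M[{mpoly K[N]}]_p) (d : 'I_p -> nat) :
  (forall i j, whomog (d j) (M i j)) -> whomog (\sum_j d j) (\det M).
Proof.
move=> hM; apply: whomog_sum => s; rewrite -signr_odd mulr_sign.
have h : whomog (\sum_j d j) (\prod_i M i (s i)).
  by rewrite (reindex_perm s); apply: whomog_prod => i; exact: hM.
by case: (odd _) => //; rewrite -scaleN1r; exact: whomogZ.
Qed.

Lemma whomogX i : whomog (w U_(i)%MM) ('X_i : {mpoly K[N]}).
Proof. by move=> a; rewrite msuppX inE => /eqP->. Qed.

End WeightedHomogeneous.

(** * Forms of bidegree (1, 2) and their tensors *)

Section Forms.
Variables (K : numFieldType) (m n : nat).
Local Notation R := {mpoly K[m.+1 + n.+1]}.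
Local Notation tens := (tensor K 'I_m.+1 'I_n.+1 'I_n.+1).
Local Notation xvar := (lshift n.+1).
Local Notation yvar := (@rshift m.+1 n.+1).

Definition tensor_form (C : tens) : R :=
  \sum_t C t *: ('X_(xvar t.1.1) * 'X_(yvar t.1.2) * 'X_(yvar t.2)).

Local Notation xd := (@xdeg m n).
Local Notation yd := (@ydeg m n).

Lemma xdegD (a b : 'X_{1..m.+1 + n.+1}) : xd (a + b)%MM = (xd a + xd b)%N.
Proof. by rewrite /xdeg -big_split; apply: eq_bigr => i _; rewrite mnmDE. Qed.

Lemma ydegD (a b : 'X_{1..m.+1 + n.+1}) : yd (a + b)%MM = (yd a + yd b)%N.
Proof. by rewrite /ydeg -big_split; apply: eq_bigr => i _; rewrite mnmDE. Qed.

Lemma xdegU (v : 'I_(m.+1 + n.+1)) : xd U_(v)%MM = (v < m.+1)%N.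
Proof.
rewrite /xdeg; case: (split_ordP v) => k ->.
  rewrite (bigD1 k) //= mnm1E eqxx big1 ?ltn_ord // => i ik.
  by rewrite mnm1E eq_shift eq_sym (negbTE ik).
by rewrite big1 /= ?ltnNge ?leq_addr // => i _; rewrite mnm1E eq_shift.
Qed.

Lemma ydegU (v : 'I_(m.+1 + n.+1)) : yd U_(v)%MM = (m.+1 <= v)%N.
Proof.
rewrite /ydeg; case: (split_ordP v) => k ->.
  by rewrite big1 /= 1?leqNgt ?ltn_ord // => i _; rewrite mnm1E eq_shift.
rewrite (bigD1 k) //= mnm1E eqxx big1 ?leq_addr // => i ik.
by rewrite mnm1E eq_shift eq_sym (negbTE ik).
Qed.

Lemma xdeg_gt0 (a : 'X_{1..m.+1 + n.+1}) d :
  xd a = d.+1 -> exists k b, [/\ a = (U_(xvar k) + b)%MM, xd b = d & yd b = yd a].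
Proof.
move=> ad; have [k ak] : exists k, a (xvar k) != 0%N.
  apply/existsP; apply: contra_eqT ad => /existsPn h.
  by rewrite /xdeg big1 // => i _; apply/eqP; have := h i; rewrite negbK.
have e : (a - U_(xvar k) + U_(xvar k))%MM = a by apply: submK; rewrite lep1mP.
exists k, (a - U_(xvar k))%MM; split; first by rewrite addmC e.
- by move: ad; rewrite -{1}e xdegD xdegU /= ltn_ord addn1 => -[].
- by rewrite -{2}e ydegD ydegU /= leqNgt ltn_ord addn0.
Qed.

Lemma ydeg_gt0 (a : 'X_{1..m.+1 + n.+1}) d :
  yd a = d.+1 -> exists k b, [/\ a = (U_(yvar k) + b)%MM, yd b = d & xd b = xd a].
Proof.
move=> ad; have [k ak] : exists k, a (yvar k) != 0%N.
  apply/existsP; apply: contra_eqT ad => /existsPn h.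
  by rewrite /ydeg big1 // => i _; apply/eqP; have := h i; rewrite negbK.
have e : (a - U_(yvar k) + U_(yvar k))%MM = a by apply: submK; rewrite lep1mP.
exists k, (a - U_(yvar k))%MM; split; first by rewrite addmC e.
- by move: ad; rewrite -{1}e ydegD ydegU /= leq_addr addn1 => -[].
- by rewrite -{2}e xdegD xdegU /= ltnNge leq_addr addn0.
Qed.

Lemma xydeg0 (a : 'X_{1..m.+1 + n.+1}) : xd a = 0%N -> yd a = 0%N -> a = 0%MM.
Proof.
move=> /eqP; rewrite sum_nat_eq0 => /forall_inP hx /eqP.
rewrite sum_nat_eq0 => /forall_inP hy.
apply/mnmP => v; rewrite mnm0E; case: (split_ordP v) => k ->.
  exact/eqP/hx.
exact/eqP/hy.
Qed.

Lemma tensor_form_linear c (C C' : tens) :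
  tensor_form (c *: C + C') = c *: tensor_form C + tensor_form C'.
Proof.
rewrite /tensor_form scaler_sumr -big_split; apply: eq_bigr => t _ /=.
by rewrite !ffunE scalerDl scalerA.
Qed.

Lemma tensor_form0 : tensor_form 0 = 0.
Proof. by rewrite /tensor_form big1 // => t _; rewrite ffunE scale0r. Qed.

(** Each monomial of the support splits off one x-variable and two y-variables; the remainder has
    bidegree (0, 0). *)
Lemma bihomog12_tensor (f : R) : bihomog 1 2 f -> exists C, f = tensor_form C.
Proof.
move=> hf; rewrite (mpolyE f) big_seq; elim/big_rec: _ => [|a g /hf[ax ay] [C ->]].
  by exists 0; rewrite tensor_form0.
have [k [b [ea bx]]] := xdeg_gt0 ax; rewrite ay => /ydeg_gt0[i [b' [eb b'y]]].
rewrite bx => b'x; have [j [b'' [eb' b''y]]] := ydeg_gt0 b'y; rewrite b'x => b''x.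
rewrite {2}ea eb eb' (xydeg0 b''x b''y) addm0 addmA !mpolyXD.
pose D : tens := [ffun t => (t == (k, i, j))%:R].
have -> : 'X_(xvar k) * 'X_(yvar i) * 'X_(yvar j) = tensor_form D.
  rewrite /tensor_form (bigD1 (k, i, j)) //= big1 => [|t /negbTE nt].
    by rewrite ffunE eqxx scale1r addr0.
  by rewrite ffunE nt scale0r.
by eexists; rewrite -tensor_form_linear.
Qed.

(** Without a factor 1/2 the result represents twice the form, and its contractions give the
    y-derivatives of the form directly. *)
Definition symmetrize (C : tens) : tens :=
  [ffun t => C t + C (t.1.1, t.2, t.1.2)].

Lemma tri_symmetrize (C : tens) v y z :
  tri (symmetrize C) v y z = tri C v y z + tri C v z y.
Proof.
rewrite -(tri_swap C v y z) -[tri C _ _ _]mul1r -tri_linear0 scale1r.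
by congr (tri _ _ _ _); apply/ffunP => t; rewrite !ffunE.
Qed.

Lemma symmetrize_sym (C : tens) : symmetric_tensor (symmetrize C).
Proof. by move=> k a b; rewrite !ffunE addrC. Qed.

Lemma tensor_form_symmetrize (C : tens) :
  tensor_form (symmetrize C) = 2 *: tensor_form C.
Proof.
have -> : symmetrize C = 1 *: C + [ffun t => C (t.1.1, t.2, t.1.2)].
  by apply/ffunP => t; rewrite !ffunE scale1r.
rewrite tensor_form_linear -[2]/(1 + 1) scalerDl; congr (_ + _).
rewrite scale1r /tensor_form.
rewrite (reindex (fun t : 'I_m.+1 * 'I_n.+1 * 'I_n.+1 => (t.1.1, t.2, t.1.2))) /=.
  by apply: eq_bigr => -[[k a] b] _ /=; rewrite ffunE /= mulrAC.
by exists (fun t : 'I_m.+1 * 'I_n.+1 * 'I_n.+1 => (t.1.1, t.2, t.1.2)) => -[[]].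
Qed.

Section Evaluation.
Variable v : 'I_(m.+1 + n.+1) -> K.
Let x : 'I_m.+1 -> K^o := fun k => v (xvar k).
Let y : 'I_n.+1 -> K^o := fun a => v (yvar a).

Lemma tensor_form_deriv_eval (C : tens) (i : 'I_(m.+1 + n.+1)) :
  (tensor_form C)^`M(i).@[v] = \sum_t C t *
    ((xvar t.1.1 == i)%:R * v (yvar t.1.2) * v (yvar t.2)
     + v (xvar t.1.1) * (yvar t.1.2 == i)%:R * v (yvar t.2)
     + v (xvar t.1.1) * v (yvar t.1.2) * (yvar t.2 == i)%:R).
Proof.
have dX j : ('X_j : R)^`M(i).@[v] = (j == i)%:R.
  rewrite mderivX mnm1E mevalZ; case: eqP => [->|_]; last by rewrite mul0r.
  have -> : (U_(i) - U_(i) = 0)%MM by apply/mnmP => l; rewrite mnmBE subnn mnm0E.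
  by rewrite mpolyX0 meval1 mulr1.
rewrite /tensor_form (big_morph (mderiv i) (mderivD i) (mderiv0 _ i)).
rewrite (big_morph (meval v) (mevalD v) (meval0 v)); apply: eq_bigr => t _ /=.
by rewrite mderivZ mevalZ !mderivM !(mevalD, mevalM) !dX !mevalXU; ring.
Qed.

Lemma tensor_form_derivx (C : tens) k :
  (tensor_form C)^`M(xvar k).@[v] = tri C (delta K k) y y.
Proof.
rewrite tensor_form_deriv_eval; apply: eq_bigr => t _.
by rewrite !eq_shift mulr0 mul0r addr0 mulr0 addr0 /delta -mulrA.
Qed.

Lemma tensor_form_derivy (C : tens) a :
  (tensor_form C)^`M(yvar a).@[v] = tri C x (delta K a) y + tri C x y (delta K a).
Proof.
rewrite tensor_form_deriv_eval -big_split; apply: eq_bigr => t _ /=.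
by rewrite !eq_shift !mul0r add0r -mulrDr.
Qed.

Lemma singular_symmetrize (C : tens) :
    (forall i, (tensor_form C)^`M(i).@[v] = 0) ->
  singular (symmetrize C) (point x y).
Proof.
move=> h; apply/singularP => -[k|a] /=; rewrite tri_symmetrize.
  by have := h (xvar k); rewrite tensor_form_derivx => ->; rewrite addr0.
by rewrite addrC -tensor_form_derivy.
Qed.

End Evaluation.

End Forms.

(** * From one nonsingular configuration to general points *)

Section General.
Variables (K : numFieldType) (m n s : nat).
Local Notation R := {mpoly K[s * (m.+1 + n.+1)]}.
Local Notation tens := (tensor K 'I_m.+1 'I_n.+1 'I_n.+1).
Local Notation xvar := (lshift n.+1).
Local Notation yvar := (@rshift m.+1 n.+1).
Local Notation var i v := ('X_(@mxvec_index s (m.+1 + n.+1) i v) : R).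

Definition singular_poly (c : 'I_s * ('I_m.+1 + 'I_n.+1)) (B : tens) : R :=
  match c.2 with
  | inl k => \sum_t (B t * (t.1.1 == k)%:R) *:
      (var c.1 (yvar t.1.2) * var c.1 (yvar t.2))
  | inr a => \sum_t (B t * (t.2 == a)%:R) *:
      (var c.1 (xvar t.1.1) * var c.1 (yvar t.1.2))
  end.

Definition bipoint_fun (P : bipoint K m n) : 'I_m.+1 + 'I_n.+1 -> K :=
  point (fun k => xcoord P 0 k) (fun a => ycoord P 0 a).

Lemma singular_polyE (P : 'I_s -> bipoint K m n) c B :
  (singular_poly c B).@[config_coords P 0] = singular_eq (bipoint_fun (P c.1)) c.2 B.
Proof.
have ex i k : config_coords P 0 (mxvec_index i (xvar k)) = xcoord (P i) 0 k.
  by rewrite mxvecE mxE /coords row_mxEl.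
have ey i a : config_coords P 0 (mxvec_index i (yvar a)) = ycoord (P i) 0 a.
  by rewrite mxvecE mxE /coords row_mxEr.
rewrite /singular_poly; case: c => i [k|a] /=;
  rewrite (big_morph (meval _) (mevalD _) (meval0 _)); apply: eq_bigr => t _ /=;
  rewrite mevalZ mevalM !mevalXU ?ex ?ey /delta /xpart /ypart /=; ring.
Qed.

Let wx (i : 'I_s) (a : 'X_{1..s * (m.+1 + n.+1)}) : nat :=
  \sum_(k < m.+1) a (mxvec_index i (xvar k)).
Let wy (i : 'I_s) (a : 'X_{1..s * (m.+1 + n.+1)}) : nat :=
  \sum_(k < n.+1) a (mxvec_index i (yvar k)).

Lemma mxvec_index_eq (p q : nat) (i i' : 'I_p) (j j' : 'I_q) :
  (mxvec_index i j == mxvec_index i' j') = (i == i') && (j == j').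
Proof.
apply/eqP/andP => [|[/eqP-> /eqP->]//].
by move=> /cast_ord_inj/enum_rank_inj[-> ->].
Qed.

Let wx0 i : wx i 0%MM = 0%N.
Proof. by rewrite /wx big1 // => k _; rewrite mnm0E. Qed.
Let wy0 i : wy i 0%MM = 0%N.
Proof. by rewrite /wy big1 // => k _; rewrite mnm0E. Qed.
Let wxD i a b : wx i (a + b)%MM = (wx i a + wx i b)%N.
Proof. by rewrite /wx -big_split; apply: eq_bigr => k _; rewrite mnmDE. Qed.
Let wyD i a b : wy i (a + b)%MM = (wy i a + wy i b)%N.
Proof. by rewrite /wy -big_split; apply: eq_bigr => k _; rewrite mnmDE. Qed.

Let wxx i i' k : wx i U_(mxvec_index i' (xvar k))%MM = (i' == i).
Proof.
rewrite /wx (bigD1 k) //= big1 => [|l lk]; rewrite mnm1E mxvec_index_eq.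
  by rewrite eqxx andbT addn0.
by rewrite eq_shift eq_sym [k == l]eq_sym (negbTE lk) andbF.
Qed.
Let wxy i i' a : wx i U_(mxvec_index i' (yvar a))%MM = 0%N.
Proof. by rewrite /wx big1 // => l _; rewrite mnm1E mxvec_index_eq eq_shift andbF. Qed.
Let wyx i i' k : wy i U_(mxvec_index i' (xvar k))%MM = 0%N.
Proof. by rewrite /wy big1 // => l _; rewrite mnm1E mxvec_index_eq eq_shift andbF. Qed.
Let wyy i i' k : wy i U_(mxvec_index i' (yvar k))%MM = (i' == i).
Proof.
rewrite /wy (bigD1 k) //= big1 => [|l lk]; rewrite mnm1E mxvec_index_eq.
  by rewrite eqxx andbT addn0.
by rewrite eq_shift eq_sym [k == l]eq_sym (negbTE lk) andbF.
Qed.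

(** Column j involves only the point [(c j).1], in bidegree (0, 2) for an x-derivative and (1, 1)
    for a y-derivative; the degrees of the determinant are the sums over the columns. *)
Lemma multihomog_minor p (c : 'I_p -> 'I_s * ('I_m.+1 + 'I_n.+1)) (B : 'I_p -> tens) :
  multihomog (\det (\matrix_(i, j) singular_poly (c j) (B i))).
Proof.
pose dx i (c : 'I_s * ('I_m.+1 + 'I_n.+1)) : nat :=
  (if c.2 is inl _ then 0 else c.1 == i)%N.
pose dy i (c : 'I_s * ('I_m.+1 + 'I_n.+1)) : nat :=
  (if c.2 is inl _ then (c.1 == i) + (c.1 == i) else c.1 == i)%N.
have hx i c' B' : whomog (wx i) (dx i c') (singular_poly c' B').
  rewrite /singular_poly /dx; case: c' => i' [k|a] /=;
    apply: whomog_sum => t; apply: whomogZ.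
    rewrite -[0%N]/(0 + 0)%N -{1}(wxy i i' t.1.2) -(wxy i i' t.2).
    by apply: (whomogM (wxD i)); apply: whomogX.
  rewrite -[nat_of_bool _]addn0 -(wxx i i' t.1.1) -(wxy i i' t.1.2).
  by apply: (whomogM (wxD i)); apply: whomogX.
have hy i c' B' : whomog (wy i) (dy i c') (singular_poly c' B').
  rewrite /singular_poly /dy; case: c' => i' [k|a] /=;
    apply: whomog_sum => t; apply: whomogZ.
    rewrite -{1}(wyy i i' t.1.2) -(wyy i i' t.2).
    by apply: (whomogM (wyD i)); apply: whomogX.
  rewrite -[nat_of_bool _]add0n -(wyy i i' t.1.2) -(wyx i i' t.1.1).
  by apply: (whomogM (wyD i)); apply: whomogX.
exists (fun i => \sum_j dx i (c j))%N, (fun i => \sum_j dy i (c j))%N => a ha i; split.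
  apply: (whomog_det (w := wx i) (wx0 i) (wxD i) (d := fun j => dx i (c j))) ha => k l.
  by rewrite mxE.
apply: (whomog_det (w := wy i) (wy0 i) (wyD i) (d := fun j => dy i (c j))) ha => k l.
by rewrite mxE.
Qed.

Lemma forms12_eq0 (P : 'I_s -> bipoint K m n) :
    nonsingular (@symmetric_tensor K _ _) (fun t => bipoint_fun (P t.1) t.2) ->
  forall f, forms12 P f -> f = 0.
Proof.
move=> hP f [/bihomog12_tensor[C fC] hf].
apply: val_inj => /=; rewrite fC.
have sC : symmetrize C = 0.
  apply: hP => [|i]; first exact: symmetrize_sym.
  have := @singular_symmetrize _ _ _ (coords (P i) 0) C.
  have -> : point (fun k => coords (P i) 0 (xvar k)) (fun a => coords (P i) 0 (yvar a))
    = bipoint_fun (P i).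
    by apply: funext => -[k|a] /=; rewrite /coords ?row_mxEl ?row_mxEr.
  by apply=> j; rewrite -fC; exact: hf.
have : 2 *: tensor_form C = 0 by rewrite -tensor_form_symmetrize sC tensor_form0.
by move=> /eqP; rewrite scaler_eq0 pnatr_eq0 => /eqP.
Qed.

Let nonzero p (v : 'rV[K]_p.+1) : 'rV[K]_p.+1 := if v == 0 then const_mx 1 else v.

Let nonzeroP p (v : 'rV[K]_p.+1) : nonzero v != 0.
Proof.
rewrite /nonzero; case: ifP => [_|->//].
by apply/eqP => /rowP/(_ ord0)/eqP; rewrite !mxE oner_eq0.
Qed.

(** The open set is the locus where one maximal minor, chosen nonzero at the given configuration,
    does not vanish. *)
Lemma for_general_forms12_eq0 (Q : 'I_s * ('I_m.+1 + 'I_n.+1) -> K) :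
    nonsingular (@symmetric_tensor K _ _) Q ->
  for_general (fun P : 'I_s -> bipoint K m n => forall f, forms12 P f -> f = 0).
Proof.
move=> hQ.
pose P0 i := BiPoint (nonzeroP (\row_k Q (i, inl k))) (nonzeroP (\row_a Q (i, inr a))).
(* Replacing a zero vector by a nonzero one only adds conditions. *)
have hP0 : nonsingular (@symmetric_tensor K _ _) (fun t => bipoint_fun (P0 t.1) t.2).
  move=> B sB hB; apply: hQ => // i.
  have [h1 h2] := hB i; move: h1 h2.
  pose x := xpart (fun t => Q (i, t)); pose y := ypart (fun t => Q (i, t)).
  have ey : y = 0 \/ ypart (bipoint_fun (P0 i)) = y.
    rewrite /ypart /= /nonzero; case: eqP => [e|_]; [left|right].
      by apply: funext => a; have /rowP/(_ a) := e; rewrite !mxE.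
    by apply: funext => a; rewrite mxE.
  have ex : x = 0 \/ xpart (bipoint_fun (P0 i)) = x.
    rewrite /xpart /= /nonzero; case: eqP => [e|_]; [left|right].
      by apply: funext => a; have /rowP/(_ a) := e; rewrite !mxE.
    by apply: funext => a; rewrite mxE.
  rewrite /singular -/x -/y; case: ey => [->|-> h1 h2].
    by move=> _ _; split=> ?; rewrite tri02.
  by split=> // z; case: ex => [->|<-//]; rewrite tri01.
have /subspace_vspace[Y hY] := symmetric_subspace K 'I_m.+1 'I_n.+1.
pose phi (P : 'I_s -> bipoint K m n) (c : 'I_s * ('I_m.+1 + 'I_n.+1)) (B : tens) :=
  singular_eq (bipoint_fun (P c.1)) c.2 B.
have phiL P c u B B' : phi P c (u *: B + B') = u * phi P c B + phi P c B'.
  exact: singular_eq_linear.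
have nonsingularE P : nonsingular (@symmetric_tensor K _ _) (fun t => bipoint_fun (P t.1) t.2)
    <-> forall B, B \in Y -> (forall c, phi P c B = 0) -> B = 0.
  split=> h B /hY YB hB; apply: h => //; last first.
    by move=> [i c]; have /singularP := hB i; exact.
  by move=> i; apply/singularP => c; exact: (hB (i, c)).
have [g g0] := (injective_minor Y (phiL P0)).1 ((nonsingularE P0).1 hP0).
pose F := \det (\matrix_(i, j) singular_poly (g j) (vbasis Y)`_i).
have FE P : F.@[config_coords P 0] = \det (\matrix_(i, j) phi P (g j) (vbasis Y)`_i).
  rewrite /F -[LHS](det_map_mx (meval (config_coords P 0))); congr (\det _).
  by apply/matrixP => i j; rewrite [LHS]mxE [in LHS]mxE [RHS]mxE; exact: singular_polyE.
exists (fun P => F.@[config_coords P 0] != 0); split.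
- exists (eq F) => [_ <-|P]; first exact: multihomog_minor.
  by split=> [h|[_ <-]//]; exists F.
- by exists P0; rewrite FE.
- move=> P; rewrite FE => h; apply: forms12_eq0; apply/nonsingularE.
  by apply/(injective_minor Y (phiL P)); exists g.
Qed.

End General.

(** * Change of index types *)

Section Transport.
Variable K : fieldType.

(** Singularity passes to pullbacks by [tri_push], and a tensor is determined by its pullback along
    surjections. *)
Lemma nonsingular_reindex (T T' I I' J J' : finType) (f : T -> T') (h : I -> I')
    (j : J' -> J) (Q : J * (T + I) -> K) (finv : T' -> T) (hinv : I' -> I) :
    cancel finv f -> cancel hinv h -> (forall i, exists i', j i' = i) ->
    nonsingular (@symmetric_tensor K T I) Q ->
  nonsingular (@symmetric_tensor K T' I')
    (fun t => point (push f (xpart (fun i => Q (j t.1, i))))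
                    (push h (ypart (fun i => Q (j t.1, i)))) t.2).
Proof.
move=> fK hK surj hQ B sB hB.
have B0 : pull f h h B = 0.
  apply: hQ => [k a b|i]; first by rewrite !ffunE sB.
  have [i' <-] := surj i; have [h1 h2] := hB i'.
  by split=> z; rewrite -tri_push; [exact: h1|exact: h2].
apply/ffunP => -[[k a] b]; have /ffunP/(_ (finv k, hinv a, hinv b)) := B0.
by rewrite !ffunE /= fK !hK.
Qed.

Lemma ord_bij (T : finType) p : #|T| = p ->
  exists f : T -> 'I_p, exists2 g : 'I_p -> T, cancel f g & cancel g f.
Proof.
move=> <-; exists enum_rank, enum_val; [exact: enum_rankK | exact: enum_valK].
Qed.

End Transport.

Lemma nondefective_of_forms12_eq0 (K : fieldType) (m n : nat) :
    superabundantA0 m n ->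
    for_general (fun P : 'I_(sbar m n) -> bipoint K m n => forall f, forms12 P f -> f = 0) ->
  nondefectiveA0 K m n.
Proof.
move=> sup [U [oU eU hU]]; exists U; split=> // P /hU hP.
exists 0%N; last by rewrite (max_idPl sup).
exists 0%VS; last exact: dimv0.
move=> f; rewrite memv0; split=> [/eqP->|/hP->//].
split=> [a|i k]; first by rewrite /= msupp0.
by rewrite /= mderiv0 meval0.
Qed.

(** * Numerical conditions *)

Section Count.
Variables q t : nat.

(** The product (2q+3)(2t+1) is odd, and rounding down then adding 1 gives exactly the q+2 base
    points and t blocks of 2q+3 points. *)
Lemma sbar_count : sbar (2 * q + 2) (2 * q + 1 + 2 * t) = (q.+2 + t * (2 * q + 3))%N.
Proof.
rewrite /sbar; have -> : ((2 * q + 2).+1 * ((2 * q + 1 + 2 * t).+2 - (2 * q + 2)) =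
  (q.+1 + t * (2 * q + 3)) * 2 + 1)%N.
  have -> : ((2 * q + 1 + 2 * t).+2 - (2 * q + 2) = 2 * t + 1)%N by lia.
  ring.
by rewrite divnMDl // divn_small // addn0 -addSn.
Qed.

(** The virtual dimension equals (2q+3)(q+1)(2q+1) - (t+2q+2), so each block lowers it by one. *)
Lemma superabundant_count :
    ((2 * q + 3) * (q + 1) * (2 * q + 1) <= t + 2 * q + 2)%N ->
  superabundantA0 (2 * q + 2) (2 * q + 1 + 2 * t).
Proof.
move=> h; rewrite /superabundantA0 /vdimA0 sbar_count subr_le0 lez_nat bin2.
have -> : ((2 * q + 1 + 2 * t).+2 * (2 * q + 1 + 2 * t).+2.-1)./2
   = ((2 * q + 3 + 2 * t) * (q + 1 + t))%N.
  by rewrite -[RHS]doubleK; congr (_./2); rewrite -mul2n -pred_Sn; ring.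
rewrite -(leq_add2r (t + 2 * q + 2)).
have -> : ((2 * q + 2).+1 * ((2 * q + 3 + 2 * t) * (q + 1 + t)) + (t + 2 * q + 2)
  = (q.+2 + t * (2 * q + 3)) * (2 * q + 2 + (2 * q + 1 + 2 * t) + 1)
    + (2 * q + 3) * (q + 1) * (2 * q + 1))%N by ring.
by rewrite leq_add2l.
Qed.

End Count.

Lemma for_general_even_odd (K : numFieldType) (q t : nat) : (0 < q)%N ->
    (q.+2 * q.+1 * (2 * q + 1) + 2 * (q.+2 * q * (2 * q + 2))
     + q * q * (2 * q + 3) + q * (2 * q + 3) <= 2 * t)%N ->
  for_general (fun P : 'I_(sbar (2 * q + 2) (2 * q + 1 + 2 * t)) ->
     bipoint K (2 * q + 2) (2 * q + 1 + 2 * t) => forall f, forms12 P f -> f = 0).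
Proof.
move=> q0 qt; pose a0 : 'I_q := Ordinal q0.
pose TI : finType := ((unit + bool) + 'I_q * bool)%type.
pose GI : finType := (bool + 'I_q)%type.
pose WI : finType := ((bool + 'I_q) + 'I_q)%type.
pose FI : finType := (WI + 'I_t * bool)%type.
(* Here [t] is both the bound on the dimension of K_0 and the number of blocks, so the dimension
   left is t - t = 0. *)
have [|th [th1 th2 th3]] := @blocks_ex K _ a0 t _ t.
  move=> Y /residual_dim; rewrite card_ord => h.
  by rewrite -(leq_pmul2l (isT : 0 < 2)%N) (leq_trans h).
have res0 (b : tensor K TI WI WI) : residual b ->
    (forall i, (i < t)%N -> extends (th i) b) -> b = 0.
  have /subspace_vspace[Y hY] := common_extension_subspace th t.
  move=> rb hb; have : (\dim Y <= t - t)%N by apply: th3 => c /hY.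
  rewrite subnn leqn0 dimv_eq0 => /eqP Y0.
  by apply/eqP; rewrite -memv0 -Y0; apply/hY.
pose J : finType := (GI + 'I_t * TI)%type.
pose Q (x : J * (TI + FI)) : K :=
  match x.1 with
  | inl i => base_point K (inl : WI -> FI) i x.2
  | inr s => block_point th s.1 s.2 x.2
  end.
have hQ : nonsingular (@symmetric_tensor K TI FI) Q.
  move=> B sB hB; apply: (assembled_eq0 (th := th)) => //.
  - by move=> i it; exact: (th1 i it).1.
  - by move=> i; exact: (hB (inl i)).
  - by move=> i k; exact: (hB (inr (i, k))).
have cT : #|TI| = (2 * q + 2).+1.
  by rewrite !card_sum card_prod card_unit card_bool card_ord; lia.
have cF : #|FI| = (2 * q + 1 + 2 * t).+1.
  by rewrite !card_sum card_prod card_bool !card_ord; lia.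
have cJ : #|J| = sbar (2 * q + 2) (2 * q + 1 + 2 * t).
  by rewrite sbar_count card_sum card_prod cT card_sum card_bool !card_ord; lia.
have [f [g fg gf]] := ord_bij cT; have [h [k hk kh]] := ord_bij cF.
have [r [u ru ur]] := ord_bij cJ.
apply: for_general_forms12_eq0 (nonsingular_reindex gf kh _ hQ).
by move=> i; exists (r i).
Qed.

Theorem theorem4p27 (R : realType) (m n : nat)
  (hm : (4 <= m)%N) (hm_even : ~~ odd m) (hn_odd : odd n)
  (hmn : (m ^ 3 - m - 3 <= n)%N) :
  superabundantA0 m n /\ nondefectiveA0 R[i] m n.
Proof.
(* [q] will be the cardinality of [A]; it is positive because m is at least 4, which provides the
   element [a0]. *)
have [q q0 mq] : exists2 q, (0 < q)%N & m = (2 * q + 2)%N.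
  by exists (m./2 - 1)%N; lia.
have cube : ((2 * q + 2) ^ 3 = 8 * (q * q * q) + 24 * (q * q) + 24 * q + 8)%N.
  by ring.
rewrite mq {hm hm_even mq} cube in hmn *.
(* W has dimension n+1 and W_0 has dimension m; the even difference n+1-m is shared out among
   planes. *)
have [t nt] : exists t, n = (2 * q + 1 + 2 * t)%N.
  by exists ((n - (2 * q + 1))./2); move: (q * q)%N (q * q * q)%N hmn => s c; lia.
rewrite nt {hn_odd nt} in hmn *.
have sup : superabundantA0 (2 * q + 2) (2 * q + 1 + 2 * t).
  (* The bound on n reads 8q^3+24q^2+20q+2 <= 2t. Both this condition and that of
     [for_general_even_odd] amount to 8q^3+24q^2+18q+2 <= 2t. *)
  by apply: superabundant_count; lia.
split=> //; apply: nondefective_of_forms12_eq0 => //.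
by apply: (@for_general_even_odd R[i]) => //; lia.
Qed.
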